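(* (i) There are no pseudo-Riemannian submersions $\pi:\mathbb HH^m_t\to B$ with connected quaternionic fibres onto a pseudo-Riemannian manifold $B$ with $1\le\dim B<\dim_{\mathbb R}\mathbb HH^m_t=4m$. (ii) There are no pseudo-Riemannian submersions $\pi:\mathbb BP^m\to B$ with connected para-quaternionic fibres onto a pseudo-Riemannian manifold $B$ with $1\le\dim B<\dim_{\mathbb R}\mathbb BP^m=4m$.
   Context: Pseudo-Riemannian submersion: a smooth surjective submersion $\pi:(M,g)\to(B,g')$ of pseudo-Riemannian manifolds such that the metric induced on every fibre is non-degenerate and $\pi_*$ preserves scalar products of vectors normal to the fibres. $\mathbb HH^m_t$ ($0\le t\le m$): give $\mathbb H^{m+1}$ the inner product $\mathrm{Re}(-\sum_{i=0}^t z_i\bar w_i+\sum_{i=t+1}^m z_i\bar w_i)$; the pseudo-hyperbolic space $H^{4m+3}_{4t+3}=\{z\in\mathbb H^{m+1}:\langle z,z\rangle=-1\}$ is acted on by the unit quaternions $S^3$ by right multiplication, and $\mathbb HH^m_t=H^{4m+3}_{4t+3}/S^3$. $\mathbb BP^m$: let $\mathbb B$ be the algebra of para-quaternions (split quaternions) with conjugation $\bar z$; put $\langle z,w\rangle=\mathrm{Re}\sum_{i=0}^m z_i\bar w_i$ on $\mathbb B^{m+1}$, $H^{4m+3}_{2m+1}=\{z\in\mathbb B^{m+1}:\langle z,z\rangle=1\}$ with metric induced by $-\langle\cdot,\cdot\rangle$, and $\mathbb BP^m=H^{4m+3}_{2m+1}/H^3_1$, where $H^3_1=\{t\in\mathbb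 B:t\bar t=1\}$ acts by right multiplication. Both quotients carry the unique pseudo-Riemannian metric making the quotient projection a pseudo-Riemannian submersion with totally geodesic fibres. $\mathbb HH^m_t$ (resp. $\mathbb BP^m$) has a natural quaternionic (resp. para-quaternionic) Kähler structure: the rank-3 bundle of endomorphisms of the tangent bundle induced by right multiplication of horizontal vectors by imaginary (para-)quaternions. Fibres are quaternionic (resp. para-quaternionic) if their tangent spaces are invariant under this bundle. *)

(* Defs.v *)
From HB Require Import structures.
From mathcomp Require Import all_boot all_order all_algebra.
From mathcomp Require Import all_classical all_reals all_analysis.
From mathcomp Require Import ring.

Set Implicit Arguments.
Unset Strict Implicit.
Unset Printing Implicit Defensive.

Import Order.TTheory GRing.Theory Num.Theory.
Import numFieldNormedType.Exports.

Local Open Scope classical_set_scope.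
Local Open Scope ring_scope.
Local Open Scope quotient_scope.

Section Smoothness.
Variables (R : realType) (V W : normedModType R).

(* Meaningful when U is open. *)
Fixpoint Cn_on (k : nat) (U : set V) (f : V -> W) : Prop :=
  match k with
  | 0%N => forall x, U x -> {for x, continuous f}
  | k'.+1 => (forall x, U x -> differentiable f x) /\
             (forall v, Cn_on k' U (fun x => 'D_v f x))
  end.

Definition smooth_on (U : set V) (f : V -> W) := forall k, Cn_on k U f.

End Smoothness.

(* The data of a manifold of dimension n with a field of bilinear forms: an
   atlas of charts [chart i : dom i -> 'rV_n] with inverses [param i], and for
   every chart i and point p of [dom i] the form [metric i p] on the tangent
   space at p, whose vectors are given by their coordinates in the chart i.
   The values of [chart i], [metric i] outside [dom i] and of [param i] outside
   [chart i @` dom i] are irrelevant. *)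
Record charted_space (R : realType) (n : nat) := ChartedSpace {
  carrier :> topologicalType ;
  chart_index : Type ;
  dom : chart_index -> set carrier ;
  chart : chart_index -> carrier -> 'rV[R]_n ;
  param : chart_index -> 'rV[R]_n -> carrier ;
  metric : chart_index -> carrier -> 'rV[R]_n -> 'rV[R]_n -> R }.

Arguments chart_index {R n} _.
Arguments dom {R n} _ _.
Arguments chart {R n} _ _ _.
Arguments param {R n} _ _ _.
Arguments metric {R n} _ _ _ _ _.

Section Manifolds.
Variable R : realType.

Definition in_charts n n' (M : charted_space R n)
    (N : charted_space R n') (i : chart_index M) (j : chart_index N)
    (f : M -> N) : 'rV[R]_n -> 'rV[R]_n' :=
  chart N j \o f \o param M i.

Definition smooth_map n n' (M : charted_space R n)
    (N : charted_space R n') (f : M -> N) :=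
  continuous f /\
  forall i j,
    smooth_on (chart M i @` (dom M i `&` f @^-1` dom N j)) (in_charts i j f).

Definition tangent_map n n' (M : charted_space R n)
    (N : charted_space R n') (i : chart_index M) (j : chart_index N)
    (f : M -> N) (p : M) : 'rV[R]_n -> 'rV[R]_n' :=
  'd (in_charts i j f) (chart M i p).

Definition smooth_manifold n (M : charted_space R n) :=
  [/\ hausdorff_space M,
      @second_countable M,
      (forall p : M, exists i, dom M i p),
      (forall i,
        [/\ open (dom M i),
            open (chart M i @` dom M i),
            (forall p, dom M i p -> {for p, continuous (chart M i)}),
            (forall x, (chart M i @` dom M i) x ->
               {for x, continuous (param M i)}) &
            (forall p, dom M i p -> param M i (chart M i p) = p)]) &
      (forall i j, smooth_on (chart M i @` (dom M i `&` dom M j))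
                             (in_charts i j (@id M)))].

Definition pseudo_riemannian_metric n (M : charted_space R n) :=
  [/\ (forall i p, dom M i p -> forall u, scalar (metric M i p u)),
      (forall i p, dom M i p ->
         forall u v, metric M i p u v = metric M i p v u),
      (forall i p, dom M i p ->
         forall u, (forall v, metric M i p u v = 0) -> u = 0),
      (forall i u v, smooth_on (chart M i @` dom M i)
         (fun x => metric M i (param M i x) u v)) &
      (forall i j p, dom M i p -> dom M j p -> forall u v,
         metric M i p u v = metric M j p (tangent_map i j (@id M) p u)
                                         (tangent_map i j (@id M) p v))].

Definition pseudo_riemannian_manifold n (M : charted_space R n) :=
  smooth_manifold M /\ pseudo_riemannian_metric M.

Section Submersion.
Variables (n n' : nat) (M : charted_space R n) (N : charted_space R n').

(* The tangent space at p of the fibre of f through p is the kernel of the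
   tangent map of f at p, f being a submersion. *)
Definition vertical i j (f : M -> N) (p : M) : set 'rV[R]_n :=
  [set u | tangent_map i j f p u = 0].

Definition normal i j (f : M -> N) (p : M) : set 'rV[R]_n :=
  [set u | forall v, vertical i j f p v -> metric M i p u v = 0].

Definition pseudo_riemannian_submersion (f : M -> N) :=
  [/\ smooth_map f,
      (forall b, exists p, f p = b) &
      forall i j p, dom M i p -> dom N j (f p) ->
      [/\ (forall w, exists u, tangent_map i j f p u = w),
          (forall u, vertical i j f p u ->
             (forall v, vertical i j f p v -> metric M i p u v = 0) -> u = 0) &
          (forall u v, normal i j f p u -> normal i j f p v ->
             metric N j (f p) (tangent_map i j f p u) (tangent_map i j f p v) =
             metric M i p u v)]].

Definition connected_fibres (f : M -> N) :=
  forall b, connected (f @^-1` [set b]).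

End Submersion.
End Manifolds.

(* For e = -1 the quaternions, for e = 1 the para-quaternions: the basis
   1, i, j, k of 'rV_4 satisfies i^2 = -1, j^2 = k^2 = e, ij = -ji = k. *)
Section Quaternions.
Variables (R : realType) (e : R).
Implicit Types p q : 'rV[R]_4.

Definition mkquat (a b c d : R) : 'rV[R]_4 := \row_k [:: a; b; c; d]`_k.

Definition qre q : R := q 0 0.

Definition qone : 'rV[R]_4 := mkquat 1 0 0 0.

Definition qconj q := mkquat (q 0 0) (- q 0 1) (- q 0 2) (- q 0 3).

Definition qmul p q := mkquat
  (p 0 0 * q 0 0 - p 0 1 * q 0 1 + e * p 0 2 * q 0 2 + e * p 0 3 * q 0 3)
  (p 0 0 * q 0 1 + p 0 1 * q 0 0 - e * p 0 2 * q 0 3 + e * p 0 3 * q 0 2)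
  (p 0 0 * q 0 2 + p 0 2 * q 0 0 - p 0 1 * q 0 3 + p 0 3 * q 0 1)
  (p 0 0 * q 0 3 + p 0 3 * q 0 0 + p 0 1 * q 0 2 - p 0 2 * q 0 1).

Definition qnorm q : R := qre (qmul q (qconj q)).

Definition qinv q := (qnorm q)^-1 *: qconj q.


Lemma quatP p q : p 0 0 = q 0 0 -> p 0 1 = q 0 1 -> p 0 2 = q 0 2 ->
  p 0 3 = q 0 3 -> p = q.
Proof.
move=> h0 h1 h2 h3; apply/rowP; case=> [[|[|[|[|//]]]] k4].
- by rewrite (_ : Ordinal k4 = 0) //; exact: val_inj.
- by rewrite (_ : Ordinal k4 = 1) //; exact: val_inj.
- by rewrite (_ : Ordinal k4 = 2) //; exact: val_inj.
- by rewrite (_ : Ordinal k4 = 3) //; exact: val_inj.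
Qed.

Lemma qmulA p q r : qmul p (qmul q r) = qmul (qmul p q) r.
Proof. by apply: quatP; rewrite !mxE /=; ring. Qed.

Lemma qmulr1 p : qmul p qone = p.
Proof. by apply: quatP; rewrite !mxE /=; ring. Qed.

Lemma qconj1 : qconj qone = qone.
Proof. by apply: quatP; rewrite !mxE /=; ring. Qed.

Lemma qconjK q : qconj (qconj q) = q.
Proof. by apply: quatP; rewrite !mxE /=; ring. Qed.

Lemma qconjM p q : qconj (qmul p q) = qmul (qconj q) (qconj p).
Proof. by apply: quatP; rewrite !mxE /=; ring. Qed.

Lemma qmulVq q : qmul (qconj q) q = qmul q (qconj q).
Proof. by apply: quatP; rewrite !mxE /=; ring. Qed.

End Quaternions.

Section ProjectiveSpaces.
Variables (R : realType) (e : R) (m t : nat).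

(* The rows of z : 'M_(m.+1, 4) are the components z_0, ..., z_m of a vector
   over the (para-)quaternions. *)
Local Notation vec := 'M[R]_(m.+1, 4).
Implicit Types z w X : vec.

Definition rscale z (q : 'rV[R]_4) : vec := \matrix_(a < m.+1) qmul e (row a z) q.

Definition qinner z w : R :=
  \sum_(a < m.+1)
    (if (a <= t)%N then -1 else 1) * qre (qmul e (row a z) (qconj (row a w))).

Definition pseudo_hyperbolic : set vec := [set z | qinner z z = -1].

Definition same_orbit (z w : pseudo_hyperbolic) : bool :=
  `[< exists s, qmul e s (qconj s) = qone R /\ \val w = rscale (\val z) s >].

Lemma same_orbit_refl : reflexive same_orbit.
Proof.
move=> z; apply/asboolP; exists (qone R); rewrite qconj1 qmulr1; split=> //.
by apply/row_matrixP => a; rewrite rowK qmulr1.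
Qed.

Lemma same_orbit_sym : symmetric same_orbit.
Proof.
suff sub (x y : pseudo_hyperbolic) : same_orbit x y -> same_orbit y x.
  by move=> x y; apply/idP/idP; exact: sub.
move=> /asboolP[s [s1 wE]]; apply/asboolP; exists (qconj s).
rewrite qconjK qmulVq; split=> //; apply/row_matrixP => a.
by rewrite wE !rowK -qmulA s1 qmulr1.
Qed.

Lemma same_orbit_trans : transitive same_orbit.
Proof.
move=> w z v /asboolP[r [r1 wE]] /asboolP[s [s1 vE]]; apply/asboolP.
exists (qmul e r s); split.
  by rewrite qconjM qmulA -(qmulA _ r) s1 qmulr1.
by apply/row_matrixP => a; rewrite vE wE !rowK qmulA.
Qed.

Canonical same_orbit_equiv :=
  EquivRel same_orbit same_orbit_refl same_orbit_sym same_orbit_trans.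

Definition proj_space : topologicalType :=
  quotient_topology {eq_quot same_orbit_equiv}.

Definition proj (z : pseudo_hyperbolic) : proj_space := \pi_proj_space z.

Lemma base_subproof : delta_mx 0 0 \in pseudo_hyperbolic.
Proof.
apply/mem_set; rewrite /pseudo_hyperbolic /= /qinner big_ord_recl big1 ?addr0.
  by rewrite /qre !mxE /=; ring.
by move=> a _; rewrite /qre !mxE /=; ring.
Qed.

Definition proj_base : proj_space := proj (SigSub base_subproof).

(* Affine coordinates z |-> (z_j z_i^-1)_(j != i), defined for z_i invertible. *)
Definition affine (i : 'I_m.+1) z : 'rV[R]_(m * 4) :=
  mxvec (\matrix_(j < m) qmul e (row (lift i j) z) (qinv e (row i z))).

(* Vectors normal to the orbit of z and tangent to [pseudo_hyperbolic], that is,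
   orthogonal to z c for every c, where c = 1 gives the tangency. *)
Definition horizontal z : set vec := [set X | forall c, qinner X (rscale z c) = 0].

(* The vector horizontal at z lying over the vector with coordinates u in the
   chart i. *)
Definition horizontal_lift i z (u : 'rV[R]_(m * 4)) : vec :=
  xget 0 [set X | horizontal z X /\ 'd (affine i) z X = u].

Definition proj_dom (i : 'I_m.+1) : set proj_space :=
  [set p | qnorm e (row i (\val (repr p))) != 0].

Definition proj_chart i (p : proj_space) := affine i (\val (repr p)).

Definition proj_param i x : proj_space :=
  xget proj_base [set p | proj_dom i p /\ proj_chart i p = x].

Definition proj_metric i (p : proj_space) u v : R :=
  qinner (horizontal_lift i (\val (repr p)) u)
         (horizontal_lift i (\val (repr p)) v).

Definition projective : charted_space R (m * 4) :=
  ChartedSpace proj_dom proj_chart proj_param proj_metric.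

(* The endomorphisms of the tangent space at p, in the coordinates of the chart
   i, induced by right multiplication of horizontal vectors by c imaginary. *)
Definition structure_bundle i (p : projective) :
    set ('rV[R]_(m * 4) -> 'rV[R]_(m * 4)) :=
  [set E | exists (z : pseudo_hyperbolic) (c : 'rV[R]_4),
     [/\ proj z = p, qre c = 0 &
         forall u, E u =
           'd (affine i) (\val z) (rscale (horizontal_lift i (\val z) u) c)]].

Definition structured_fibres n (B : charted_space R n) (f : projective -> B) :=
  forall i j p, dom projective i p -> dom B j (f p) ->
  forall E u, structure_bundle i p E ->
    vertical i j f p u -> vertical i j f p (E u).

End ProjectiveSpaces.

Definition HH (R : realType) (m t : nat) := projective (-1 : R) m t.

(* With e = 1 and t = m, [qinner z w] is - Re (\sum_a z_a \bar w_a), so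
   [pseudo_hyperbolic] is {z | Re (\sum_a z_a \bar z_a) = 1} with the metric
   induced by [qinner]. *)
Definition BP (R : realType) (m : nat) := projective (1 : R) m m.

Definition quaternionic_fibres (R : realType) (m t n : nat)
  (B : charted_space R n) (f : HH R m t -> B) := structured_fibres f.

Definition paraquaternionic_fibres (R : realType) (m n : nat)
  (B : charted_space R n) (f : BP R m -> B) := structured_fibres f.

(* Main.v *)
(* In the affine chart around [1 : 0 : ... : 0], let D(x) be the jacobian of the
   submersion f and S(u, w) = D_u D_w f its hessian. The kernel of D(x) is stable
   under right multiplication by (para-)quaternions, so S(u q, w) depends on
   S(u, w) through an endomorphism J_q of the image whenever D u = 0. For u, w
   both vertical, symmetry lets J_i and J_j act in either order although they
   anticommute, whence S(u, w) = 0. Since f pushes the cometric P forward,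
   D^T P D depends on f(x) only; differentiating it along a vertical w and using
   S(w q, u) = J_q S(w, u) determines S(w, .) completely:
     (1 - <x, x>) S(w, u) = D(u h(x, w)),
   h being the (para-)quaternionic hermitian form.
   Differentiating this once more at x = 0, along w and along Y, the third
   derivative D_w D_w D_Y f is found to equal both <w, w> D_Y f and 0. As w can
   be chosen non-null and Y not vertical, this is a contradiction. *)

Require Import Defs.
From HB Require Import structures.
From mathcomp Require Import all_boot all_order all_algebra.
From mathcomp Require Import all_classical all_reals all_analysis.
From mathcomp Require Import perm ring.

Set Implicit Arguments.
Unset Strict Implicit.
Unset Printing Implicit Defensive.

Import Order.TTheory GRing.Theory Num.Theory.
Import numFieldNormedType.Exports.

Local Open Scope classical_set_scope.
Local Open Scope ring_scope.

(** The cometric is used because it pushes forward through [D] without any horizontal projection and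
    is polynomial in the affine coordinates, namely N (b - [quat_proj x]) with N = 1 - <x, x>, which
    is minus the norm of the homogeneous vector (1, x). The hessian coefficients come from the
    logarithmic derivative of N along w; the variation of [quat_proj] yields only factors D(w q) =
    0. For each of the three units, comparing w with w q gives the anticommutator of J_q with the
    endomorphism induced by S(w, .); together they determine it, since only 0 anticommutes with J_i,
    J_j and J_i J_j. The kernel of D moves with x, so a vertical vector must be extended to a
    vertical field before an identity about it is differentiated. At x = 0 the map S(w, .) vanishes,
    and this removes the derivative of that field from the third derivative. In one order of
    differentiation only <w, w> survives, as <w, w q> = 0 for imaginary q; in the other order every
    term has a factor D(w q) = 0. Both algebras are treated at once: of e, the computations use only
    e * e = 1. *)

Section HessianAlgebra.

(** * Linear algebra at one point; vectors are rows, so [u *m D] is the derivative along [u] *)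

Variables (R : realFieldType) (d n : nat) (e : R) (I J : 'M[R]_d).
Local Notation K := (I *m J).
Hypothesis (ee : e * e = 1) (II : I *m I = - 1%:M) (JJ : J *m J = e%:M)
  (JI : J *m I = - K).

Let e_neq0 : e != 0.
Proof. by apply: contra_eq_neq ee => ->; rewrite mul0r eq_sym oner_eq0. Qed.

(** Moving [t] past [A] and then past [B] changes the sign twice, so [t] commutes with [A *m B] as
    well as anticommuting with it; and [A], [B] are invertible. *)
Lemma anticommuting_mx_eq0 (A B t : 'M[R]_n) :
  A *m A = - 1%:M -> B *m B = e%:M ->
  t *m A = - (A *m t) -> t *m B = - (B *m t) ->
  t *m (A *m B) = - (A *m B *m t) -> t = 0.
Proof.
move=> AA BB tA tB tAB.
have : A *m B *m t *+ 2 = 0.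
  rewrite mulr2n -[X in _ + X]opprK -tAB mulmxA tA mulNmx opprK -[X in _ + X]mulmxA.
  by rewrite tB mulmxN mulmxA subrr.
rewrite -scaler_nat => /eqP; rewrite scaler_eq0 pnatr_eq0 /= => /eqP.
move=> /(congr1 (fun X => B *m (A *m X))).
rewrite !mulmx0 !mulmxA -[B *m A *m A]mulmxA AA mulmxN mulmx1 mulNmx BB => /eqP.
rewrite mulNmx oppr_eq0 mul_scalar_mx scaler_eq0.
by rewrite (negPf e_neq0) => /eqP.
Qed.

Variables (D : 'M[R]_(d, n)) (L : 'M[R]_(n, d)).
Hypothesis LD : L *m D = 1%:M.
Hypotheses (kerI : forall u : 'rV_d, u *m D = 0 -> u *m I *m D = 0)
  (kerJ : forall u : 'rV_d, u *m D = 0 -> u *m J *m D = 0).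

(* The endomorphism of the image of [D] induced by [Q], see [descend_mx]. *)
Local Notation "Q ^D" := (L *m Q *m D) (at level 1, format "Q ^D").

(** The rows of [1%:M - D *m L] lie in the kernel of [D], which [Q] preserves. *)
Lemma descend_mx (Q : 'M[R]_d) :
  (forall u : 'rV_d, u *m D = 0 -> u *m Q *m D = 0) -> Q *m D = D *m Q^D.
Proof.
move=> kerQ; have kerM (A : 'M[R]_d) : A *m D = 0 -> A *m Q *m D = 0.
  by move=> AD; apply/row_matrixP => i; rewrite !row_mul kerQ ?row0// -row_mul AD
    row0.
have /kerM : (1%:M - D *m L) *m D = 0 by rewrite mulmxBl mul1mx -mulmxA LD mulmx1
  subrr.
by rewrite !mulmxBl mul1mx => /subr0_eq ->; rewrite !mulmxA.
Qed.

Let DI : I *m D = D *m I^D. Proof. exact: descend_mx. Qed.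
Let DJ : J *m D = D *m J^D. Proof. exact: descend_mx. Qed.

Let cancelD p (A B : 'M[R]_(n, p)) : D *m A = D *m B -> A = B.
Proof. by move=> /(congr1 (mulmx L)); rewrite !mulmxA LD !mul1mx. Qed.

Let IID : I^D *m I^D = - 1%:M.
Proof.
apply: cancelD; rewrite mulmxA -DI -mulmxA -DI mulmxA II.
by rewrite mulNmx mul1mx mulmxN mulmx1.
Qed.

Let JJD : J^D *m J^D = e%:M.
Proof.
by apply: cancelD; rewrite mulmxA -DJ -mulmxA -DJ mulmxA JJ mul_scalar_mx
  mul_mx_scalar.
Qed.

Let KDE : I^D *m J^D = K^D.
Proof.
apply: cancelD; rewrite mulmxA -DI -mulmxA -DJ mulmxA.
rewrite -[LHS]mul1mx; apply: etrans (descend_mx _); first by rewrite mul1mx.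
by move=> u uD; rewrite mulmxA kerJ// kerI.
Qed.

Let JID : J^D *m I^D = - (I^D *m J^D).
Proof.
apply: cancelD; rewrite mulmxA -DJ -mulmxA -DI mulmxA JI mulNmx mulmxN.
by rewrite -[I *m J *m D]mulmxA DJ mulmxA DI -[D *m _ *m _]mulmxA.
Qed.

(* [u *m S w] stands for the second derivative along [u] and [w] of the map
   with jacobian [D]. *)
Variable S : 'rV[R]_d -> 'M[R]_(d, n).
Hypothesis SC : forall u v : 'rV_d, u *m S v = v *m S u.
Hypothesis SI : forall w u : 'rV_d, u *m D = 0 -> u *m I *m S w = u *m S w *m I^D.
Hypothesis SJ : forall w u : 'rV_d, u *m D = 0 -> u *m J *m S w = u *m S w *m J^D.

Lemma second_fundamental_form0 (u w : 'rV_d) : u *m D = 0 -> w *m D = 0 ->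
  u *m S w = 0.
Proof.
move=> uD wD.
have IJ1 : u *m I *m S (w *m J) = u *m S w *m (I^D *m J^D).
  by rewrite SC SJ// SC SI// -mulmxA.
have IJ2 : u *m I *m S (w *m J) = u *m S w *m (J^D *m I^D).
  by rewrite SI// SC SJ// SC -mulmxA.
have : u *m S w *m (I^D *m J^D) = 0.
  have : u *m S w *m (I^D *m J^D) *+ 2 = 0.
    by rewrite mulr2n -{2}IJ1 IJ2 JID mulmxN subrr.
  by rewrite -scaler_nat => /eqP; rewrite scaler_eq0 pnatr_eq0 /= => /eqP.
move: (_ *m S w) IID JJD => v; move: I^D J^D => A B AA BB.
move=> /(congr1 (fun X => X *m B *m A)); rewrite !mulmxA -[v *m A *m B *m B]mulmxA.
rewrite BB mul_mx_scalar -scalemxAl -mulmxA AA !mul0mx mulmxN mulmx1 => /eqP.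
by rewrite scaler_eq0 oppr_eq0 (negPf e_neq0) => /eqP.
Qed.

(** Vanishing on vertical vectors, [S v] factors through the image of [D]; the induced endomorphism
    [L *m S v] is the unknown of what follows. *)
Let hessian_descend (v : 'rV_d) : v *m D = 0 -> S v = D *m (L *m S v).
Proof.
move=> vD; apply/eqP; rewrite -subr_eq0 mulmxA -[X in X - _]mul1mx -mulmxBl.
apply/eqP/row_matrixP => i; rewrite row_mul row0 second_fundamental_form0//.
by rewrite -row_mul mulmxBl mul1mx -mulmxA LD mulmx1 subrr row0.
Qed.

Variables (P : 'M[R]_d) (lam : 'rV[R]_d -> R) (gam : 'M[R]_n).
Hypotheses (PI : I^T *m P = - (P *m I)) (PJ : J^T *m P = - (P *m J)).
Local Notation C := (D^T *m P *m D).
Hypothesis gamC : gam *m C = 1%:M.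
Hypothesis metric_hessian : forall w : 'rV_d, w *m D = 0 ->
  (S w)^T *m P *m D + D^T *m P *m S w = lam w *+ 2 *: C.

Let cancelC (A B : 'M[R]_n) : C *m A = C *m B -> A = B.
Proof.
by move=> /(congr1 (mulmx gam)); rewrite (mulmxA gam C A) (mulmxA gam C B) gamC
  !mul1mx.
Qed.

(* For vertical [w], the vanishing derivative of the cometric [C] makes
   [C *m L *m S w] skew up to [lam w]; comparing with the same for [w *m Q]
   yields this anticommutation defect. *)
Let hessian_anticomm (w : 'rV_d) Q (w' := w *m Q) :
    (forall u : 'rV_d, u *m D = 0 -> u *m Q *m D = 0) ->
    (forall w u : 'rV_d, u *m D = 0 -> u *m Q *m S w = u *m S w *m Q^D) ->
    Q^T *m P = - (P *m Q) -> w *m D = 0 ->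
  L *m S w *m Q^D + Q^D *m (L *m S w) = lam w *+ 2 *: Q^D + (lam w' *+ 2)%:M.
Proof.
move=> kerQ SQ PQ wD.
have Sw' : S w' = S w *m Q^D.
  apply/row_matrixP => i; rewrite rowE [RHS]row_mul (rowE i (S w)) (SC _ w') SQ//.
  by rewrite (SC w).
have sE : S w = D *m (L *m S w) by exact: hessian_descend.
have QD := descend_mx kerQ.
have : w' *m D = 0 by exact: kerQ.
move: sE QD; have := metric_hessian wD; move: Sw'.
move: Q^D (L *m S w) => A s Sw' + sE QD /metric_hessian; rewrite Sw' sE.
(* Skewness of [Q] for [P] passes to the induced [A] and the pushed-forward cometric [C]. *)
have CQ : A^T *m C = - (C *m A).
  rewrite !mulmxA -trmx_mul -QD trmx_mul -(mulmxA D^T Q^T P) PQ mulmxN mulNmx.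
  by rewrite mulmxA -(mulmxA _ Q D) QD !mulmxA.
have tr X : (D *m X)^T *m P *m D = X^T *m C by rewrite trmx_mul !mulmxA.
have tr' X : D^T *m P *m (D *m X) = C *m X by rewrite mulmxA.
have -> : D *m s *m A = D *m (s *m A) by rewrite -mulmxA.
rewrite !tr !tr' trmx_mul -(mulmxA A^T s^T C) => /(canRL (addrK _)) ->.
rewrite mulmxBr -scalemxAr (mulmxA A^T C s) CQ mulNmx -(mulmxA C A s) (mulmxA C s
  A).
move: tr tr' CQ; move: C cancelC => C' inj _ _ _ AE.
apply: inj; rewrite !mulmxDr mul_mx_scalar -AE -scalemxAr mulmxA.
by apply/matrixP => i j; rewrite !mxE; ring.
Qed.

Lemma hessian_formula (w : 'rV_d) : w *m D = 0 ->
  S w = lam w *: D - lam (w *m I) *: (I *m D)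
        + (e * lam (w *m J)) *: (J *m D) + (e * lam (w *m K)) *: (K *m D).
Proof.
move=> wD; rewrite (hessian_descend wD).
have kerK (u : 'rV_d) : u *m D = 0 -> u *m K *m D = 0.
  by move=> uD; rewrite mulmxA kerJ// kerI.
have SK w' (u : 'rV_d) : u *m D = 0 -> u *m K *m S w' = u *m S w' *m K^D.
  by move=> uD; rewrite mulmxA SJ ?kerI// SI// -mulmxA KDE.
have PK : K^T *m P = - (P *m K).
  by rewrite trmx_mul -(mulmxA J^T I^T) PI mulmxN (mulmxA J^T) PJ mulNmx opprK
    -(mulmxA P) JI mulmxN.
have := hessian_anticomm kerI SI PI wD.
have := hessian_anticomm kerJ SJ PJ wD.
have := hessian_anticomm kerK SK PK wD.
rewrite DI DJ (descend_mx kerK) -KDE.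
move: (lam w) (lam (w *m K)) (lam (w *m J)) (lam (w *m I)) (L *m S w) => l0 lK lJ
  lI s.
move: I^D J^D IID JJD JID => A B AA BB BA sK sJ sI.
have AAB : A *m (A *m B) = - B by rewrite mulmxA AA mulNmx mul1mx.
have BAB : B *m (A *m B) = - (e *: A).
  by rewrite mulmxA BA mulNmx -mulmxA BB mul_mx_scalar.
have ABA : A *m B *m A = B by rewrite -mulmxA BA mulmxN AAB opprK.
have ABB : A *m B *m B = e *: A by rewrite -mulmxA BB mul_mx_scalar.
have ABAB : A *m B *m (A *m B) = e%:M by rewrite mulmxA ABA BB.
(* A particular solution of the three anticommutator equations: its coefficients come from the
   inverses [- A], [e *: B] and [e *: (A *m B)] of the three units. The difference [t] anticommutes
   with all of them. *)
pose t := s - (l0%:M - lI *: A + (e * lJ) *: B + (e * lK) *: (A *m B)).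
suff : t = 0.
  move/eqP; rewrite subr_eq0 => /eqP ->.
  by rewrite !mulmxDr mulmxN mul_mx_scalar -!scalemxAr.
rewrite /t; apply: (anticommuting_mx_eq0 AA BB);
  rewrite !(mulmxDl, mulmxDr, mulNmx, mulmxN) -!scalemxAl -!scalemxAr
    mul_scalar_mx mul_mx_scalar.
- rewrite (canRL (addrK _) sI) AA ABA BA AAB; move: (A *m s) (A *m B) => X Y.
  by apply/matrixP => i j; rewrite !mxE; case: (i == j) => /=; ring.
- rewrite (canRL (addrK _) sJ) BB ABB BA BAB; move: (B *m s) (A *m B) => X Y.
  by apply/matrixP => i j; rewrite !mxE; case: (i == j) => /=; ring: ee.
- rewrite (canRL (addrK _) sK) AAB ABA BAB ABB ABAB.
  move: (A *m B *m s) (A *m B) => X Y.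
  by apply/matrixP => i j; rewrite !mxE; case: (i == j) => /=; ring: ee.
Qed.
End HessianAlgebra.

(** * The projective metric and its inverse in affine coordinates *)

Section MetricAlgebra.
Variables (R : realFieldType) (d : nat) (e : R) (I J b : 'M[R]_d).
Local Notation K := (I *m J).

(* Rows [x], [x i], [x j], [x k]. *)
Definition quat_frame (x : 'rV[R]_d) : 'M[R]_(4, d) :=
  \matrix_(k < 4) (x *m nth 0 [:: 1%:M; I; J; K] k).

(** The norm form of the (para-)quaternions in the basis 1, i, j, k. *)
Definition quat_form : 'M[R]_4 := diag_mx (\row_(k < 4) [:: 1; 1; - e; - e]`_k).

Definition hyp_factor (x : 'rV[R]_d) : R := 1 - (x *m b *m x^T) 0 0.

(** On rows, [b *m quat_proj x] acts as <x, x> times the orthogonal projection onto the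
    (para-)quaternionic line of [x], when that line is non-degenerate. *)
Definition quat_proj x : 'M[R]_d := (quat_frame x)^T *m quat_form *m quat_frame x.

(* The metric of the projective space in affine coordinates; its inverse is
   [proj_cogram]. *)
Definition proj_gram x : 'M[R]_d :=
  (hyp_factor x)^-1 *: (b + (hyp_factor x)^-1 *: (b *m quat_proj x *m b)).

Definition proj_cogram x : 'M[R]_d := hyp_factor x *: (b - quat_proj x).

Lemma quat_projE x : quat_proj x =
  x^T *m x + (x *m I)^T *m (x *m I) - e *: ((x *m J)^T *m (x *m J))
  - e *: ((x *m K)^T *m (x *m K)).
Proof.
have outer (u v : 'rV[R]_d) i j : (u^T *m v) i j = u 0 i * v 0 j.
  by rewrite !mxE big_ord1 !mxE.
rewrite /quat_proj /quat_form mul_mx_diag; apply/matrixP => i j.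
transitivity (\sum_(k < 4) [:: 1; 1; - e; - e]`_k *
    ((x *m [:: 1%:M; I; J; K]`_k) 0 i * (x *m [:: 1%:M; I; J; K]`_k) 0 j)).
  by rewrite mxE; apply: eq_bigr => k _; rewrite !mxE; ring.
rewrite !big_ord_recl big_ord0 !lift0/= mulmx1.
have entry (A B C D' : 'M[R]_d) :
    (A + B - e *: C - e *: D') i j = A i j + B i j - e * C i j - e * D' i j.
  by rewrite !mxE.
by rewrite entry !outer; ring.
Qed.

Hypothesis (ee : e * e = 1) (II : I *m I = - 1%:M) (JJ : J *m J = e%:M)
  (JI : J *m I = - K).
Hypotheses (bT : b^T = b) (bb : b *m b = 1%:M)
  (Ib : I *m b = - (b *m I^T)) (Jb : J *m b = - (b *m J^T)).

Let KK : K *m K = e%:M.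
Proof.
by rewrite -mulmxA (mulmxA J) JI mulNmx mulmxN -mulmxA JJ mulmxA II mulNmx mul1mx
  opprK.
Qed.

Let IK : I *m K = - J. Proof. by rewrite mulmxA II mulNmx mul1mx. Qed.
Let KI : K *m I = J. Proof. by rewrite -mulmxA JI mulmxN IK opprK. Qed.
Let KJ : K *m J = e *: I. Proof. by rewrite -mulmxA JJ mul_mx_scalar. Qed.
Let JK : J *m K = - (e *: I).
Proof. by rewrite mulmxA JI mulNmx KJ. Qed.

Let Kb : K *m b = - (b *m K^T).
Proof.
by rewrite -mulmxA Jb mulmxN mulmxA Ib mulNmx opprK -mulmxA -trmx_mul JI linearN
  mulmxN.
Qed.

Lemma skew_form_eq0 (x : 'rV[R]_d) (A : 'M[R]_d) : A *m b = - (b *m A^T) ->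
  (x *m A *m b *m x^T) 0 0 = 0.
Proof.
move=> Ab; have : (x *m A *m b *m x^T)^T = - (x *m A *m b *m x^T).
  by rewrite !trmx_mul trmxK bT -(mulmxA x A b) Ab mulmxN mulNmx opprK !mulmxA.
move=> /matrixP/(_ 0 0); rewrite [LHS]mxE [RHS]mxE => /eqP;
  rewrite -addr_eq0 -mulr2n mulrn_eq0 /=.
by move=> /eqP.
Qed.

(** The imaginary units are skew for [b], so <x p, x q> reduces to a form <x r, x> with [r] a
    multiple of one unit, and this vanishes unless [r] is real. *)
Lemma quat_frame_gram x :
  quat_frame x *m b *m (quat_frame x)^T = (1 - hyp_factor x) *: quat_form.
Proof.
have adj (A B : 'M[R]_d) :
    (x *m A *m b *m (x *m B)^T) 0 0 = (x *m (A *m b *m B^T) *m x^T) 0 0.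
  by rewrite trmx_mul !mulmxA.
have N1 : 1 - hyp_factor x = (x *m b *m x^T) 0 0.
  by rewrite /hyp_factor opprB addrCA subrr addr0.
have eI := skew_form_eq0 x Ib; have eJ := skew_form_eq0 x Jb;
  have eK := skew_form_eq0 x Kb.
have bI : b *m I^T = - (I *m b) by rewrite Ib opprK.
have bJ : b *m J^T = - (J *m b) by rewrite Jb opprK.
have bK : b *m K^T = - (K *m b) by rewrite Kb opprK.
have entry k l : (quat_frame x *m b *m (quat_frame x)^T) k l =
    (x *m (nth 0 [:: 1%:M; I; J; K] k *m b *m
           (nth 0 [:: 1%:M; I; J; K] l)^T) *m x^T) 0 0.
  rewrite -adj; rewrite mxE [RHS]mxE; apply: eq_bigr => j _; rewrite !mxE;
    congr (_ * _).
  by apply: eq_bigr => i _; rewrite mxE.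
have b4 : [/\ b *m 1%:M^T = b, b *m I^T = - (I *m b), b *m J^T = - (J *m b) &
  b *m K^T = - (K *m b)] by rewrite trmx1 mulmx1 Ib Jb Kb !opprK.
apply/matrixP => k l; rewrite entry [RHS]mxE N1; move: b4 => [b1 b2 b3 b4'].
have oppE (A : 'M[R]_1) : (- A) 0 0 = - A 0 0 by rewrite mxE.
have qZ c A : (x *m (c *: A) *m x^T) 0 0 = c * (x *m A *m x^T) 0 0.
  by rewrite -scalemxAr -scalemxAl mxE.
rewrite -!mulmxA in eI eJ eK.
have {}eI : (x *m (I *m b) *m x^T) 0 0 = 0 by rewrite -!mulmxA.
have {}eJ : (x *m (J *m b) *m x^T) 0 0 = 0 by rewrite -!mulmxA.
have {}eK : (x *m (K *m b) *m x^T) 0 0 = 0 by rewrite -!mulmxA.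
have IKb : I *m (K *m b) = - (J *m b) by rewrite mulmxA IK mulNmx.
have [IIb JJb KKb] : [/\ I *m (I *m b) = - b, J *m (J *m b) = e *: b &
    K *m (K *m b) = e *: b].
  by split; rewrite mulmxA ?II ?JJ ?KK ?mulNmx ?mul_scalar_mx ?mul1mx ?scale1r.
have JIb : J *m (I *m b) = - (K *m b) by rewrite mulmxA JI mulNmx.
have IJb : I *m (J *m b) = K *m b by rewrite mulmxA.
have JKb : J *m (K *m b) = - (e *: (I *m b)) by rewrite mulmxA JK mulNmx scalemxAl.
have KIb : K *m (I *m b) = J *m b by rewrite mulmxA KI.
have KJb : K *m (J *m b) = e *: (I *m b) by rewrite mulmxA KJ scalemxAl.
case: k => [[|[|[|[|]]]]]//= ?; case: l => [[|[|[|[|]]]]]//= ?;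
  rewrite [quat_form _ _]mxE [X in X *+ _]mxE/= -(mulmxA _ b) ?(b1, b2, b3, b4')
    ?mul1mx
    ?mulmxN ?(IKb, IIb, JJb, KKb, JIb, IJb, JKb, KIb, KJb) ?(mulmxN, mulNmx, opprK)
    ?oppE ?qZ ?(eI, eJ, eK) ?mulr1n ?mulr0n.
all: try by ring.
Qed.

(** With M = [quat_proj x], orthogonality of the frame gives M b M = (1 - N) M, so the inverse of b
    - M is the combination b + N^-1 b M b. *)
Lemma proj_cogramK x : hyp_factor x != 0 -> proj_cogram x *m proj_gram x = 1%:M.
Proof.
move=> N0; rewrite /proj_cogram /proj_gram -scalemxAl -scalemxAr scalerA mulfV//
  scale1r.
have form2 : quat_form *m quat_form = 1%:M.
  rewrite mulmx_diag -[RHS]diag_const_mx; congr diag_mx; apply/rowP => k;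
    rewrite !mxE.
  by case: k => [[|[|[|[|]]]]]//= _; rewrite ?mulr1 ?mulrNN.
have MbM : quat_proj x *m b *m quat_proj x = (1 - hyp_factor x) *: quat_proj x.
  rewrite /quat_proj; rewrite -!mulmxA (mulmxA (quat_frame x) b) (mulmxA _
    (quat_frame x)^T).
  rewrite quat_frame_gram -scalemxAl -!scalemxAr (mulmxA quat_form) form2.
  by rewrite mul1mx.
move: (quat_proj x) MbM => M MbM; rewrite mulmxDr -scalemxAr !mulmxBl !mulmxA bb
  mul1mx MbM -scalemxAl.
move: (M *m b) => X; apply/matrixP => i j; rewrite !mxE; field.
by [].
Qed.

Lemma proj_cogram_sym x : (proj_cogram x)^T = proj_cogram x.
Proof.
by rewrite /proj_cogram linearZ linearB /= bT /quat_proj !trmx_mul trmxK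
  tr_diag_mx !mulmxA.
Qed.

Let trS (Q : 'M[R]_d) (u v : 'rV[R]_d) : Q^T *m (u^T *m v) = (u *m Q)^T *m v.
Proof. by rewrite mulmxA -trmx_mul. Qed.

(** Right multiplication by i permutes x, x i, x j, x k up to sign, so the contributions of the
    frame to the two sides cancel in pairs. *)
Lemma proj_cogram_skewI x : I^T *m proj_cogram x = - (proj_cogram x *m I).
Proof.
have Itb : I^T *m b = - (b *m I).
  rewrite -[I in RHS]mulmx1 -bb !mulmxA -(mulmxA b I b) Ib mulmxN mulNmx opprK.
  by rewrite mulmxA bb mul1mx.
rewrite /proj_cogram -scalemxAl -scalemxAr -scalerN; congr (_ *: _).
rewrite mulmxBl mulmxBr Itb opprB addrC; congr (_ - _).
rewrite quat_projE !mulmxDl !mulmxDr !mulNmx !mulmxN -!scalemxAl -!scalemxAr !trS.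
rewrite -!(mulmxA _^T) -!(mulmxA x) II JI KI.
have trN (u : 'rV[R]_d) : (- u)^T = - u^T by rewrite linearN.
rewrite !(mulmxN x) !trN mulmx1 ?(mulNmx, mulmxN, scalerN).
move: (_^T *m x) (x^T *m _) (_^T *m (x *m K)) (_^T *m (x *m J)) => X1 X2 X3 X4.
by apply/matrixP => i j; rewrite !mxE; ring.
Qed.

Lemma proj_cogram_skewJ x : J^T *m proj_cogram x = - (proj_cogram x *m J).
Proof.
have Jtb : J^T *m b = - (b *m J).
  rewrite -[J in RHS]mulmx1 -bb !mulmxA -(mulmxA b J b) Jb mulmxN mulNmx opprK.
  by rewrite mulmxA bb mul1mx.
rewrite /proj_cogram -scalemxAl -scalemxAr -scalerN; congr (_ *: _).
rewrite mulmxBl mulmxBr Jtb opprB addrC; congr (_ - _).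
rewrite quat_projE !mulmxDl !mulmxDr !mulNmx !mulmxN -!scalemxAl -!scalemxAr !trS.
rewrite -!(mulmxA _^T) -!(mulmxA x) JJ KJ.
rewrite !mul_mx_scalar -!(scalemxAr _ x) !linearZ/= -!scalemxAl.
move: (_^T *m x) (x^T *m _) (_^T *m (x *m K)) (_^T *m (x *m I)) => X1 X2 X3 X4.
apply/matrixP => i j; rewrite !mxE; ring: ee.
Qed.

End MetricAlgebra.

(** * Calculus of matrix-valued maps and symmetry of second derivatives *)

Section Derivatives.
Context {R : realType} {V : normedModType R}.
Implicit Types (x u v : V).

Lemma derivable_prod (I : Type) (r : seq I) (F : I -> V -> R) x v :
  (forall i, derivable (F i) x v) -> derivable (fun t => \prod_(i <- r) F i t) x v.
Proof.
move=> dF; elim: r => [|i r IH].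
  rewrite (_ : (fun _ => _) = cst 1); first exact: derivable_cst.
  by apply/funext => t; rewrite big_nil.
rewrite (_ : (fun _ => _) = F i * (fun t => \prod_(i <- r) F i t)).
  exact: derivableM (dF i) IH.
by apply/funext => t; rewrite big_cons.
Qed.

Lemma derivable_sum_fun (I : Type) (r : seq I) (F : I -> V -> R) x v :
  (forall i, derivable (F i) x v) -> derivable (fun t => \sum_(i <- r) F i t) x v.
Proof.
move=> dF; elim: r => [|i r IH].
  rewrite (_ : (fun _ => _) = cst 0); first exact: derivable_cst.
  by apply/funext => t; rewrite big_nil.
rewrite (_ : (fun _ => _) = F i + (fun t => \sum_(i <- r) F i t)).
  exact: derivableD (dF i) IH.
by apply/funext => t; rewrite big_cons.
Qed.

Lemma derivable_det n (A : V -> 'M[R]_n) x v :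
  derivable A x v -> derivable (fun t => \det (A t)) x v.
Proof.
move=> /derivable_mxP dA; apply: derivable_sum_fun => s.
rewrite (_ : (fun _ => _) = cst ((-1) ^+ s) * (fun t => \prod_i A t i (s i))) //.
by apply: derivableM; [exact: derivable_cst|exact: derivable_prod].
Qed.

Lemma derivable_adj n (A : V -> 'M[R]_n) x v :
  derivable A x v -> derivable (fun t => \adj (A t)) x v.
Proof.
move=> dA; apply/derivable_mxP => i j.
rewrite (_ : (fun _ => _) = cst ((-1) ^+ (j + i)) * (fun t => \det (row' j (col'
  i (A t))))).
  apply: derivableM; first exact: derivable_cst.
  apply: derivable_det; apply/derivable_mxP => k l.
  move/derivable_mxP : dA => /(_ (lift j k) (lift i l)).
  by congr (derivable _ x v); apply/funext => t; rewrite !mxE.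
by apply/funext => t; rewrite mxE.
Qed.

Lemma is_derive_mulmx m n p (A : V -> 'M[R]_(m, n)) (B : V ->
  'M[R]_(n, p)) x v dA dB :
  is_derive x v A dA -> is_derive x v B dB ->
  is_derive x v (fun t => A t *m B t) (dA *m B x + A x *m dB).
Proof.
move=> [dAx <-] [dBx <-].
have /derivable_mxP dA' := dAx; have /derivable_mxP dB' := dBx.
have dAB i j : is_derive x v (fun t => (A t *m B t) i j)
    (('D_v A x *m B x + A x *m 'D_v B x) i j).
  rewrite (_ : (fun _ => _) = \sum_k ((fun t => A t i k) * (fun t => B t k j)));
    last first.
    by apply/funext => t; rewrite !mxE fct_sumE.
  apply: is_derive_eq; first by apply: is_derive_sum => k; apply: is_deriveM;
    exact: derivableP.
  rewrite !mxE -big_split/=; apply: eq_bigr => k _.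
  by rewrite derive_mx// derive_mx// !mxE /GRing.scale/= mulrC addrC (mulrC (B x
    k j)) (mulrC _ (A x i k)).
have dAB' : derivable (fun t => A t *m B t) x v by apply/derivable_mxP => i j.
apply: DeriveDef => //; rewrite derive_mx//; apply/matrixP => i j.
by rewrite mxE; exact: derive_val.
Qed.

(* The field [det (L A) w - w A adj(L A) L] lies in the kernel of A identically,
   without any invertibility assumption away from x. *)
Lemma kernel_field d n (A : V -> 'M[R]_(d, n)) (L : 'M[R]_(n, d)) (w : 'rV[R]_d)
  x v :
  derivable A x v -> L *m A x = 1%:M -> w *m A x = 0 ->
  exists W : V -> 'rV[R]_d,
    [/\ derivable W x v, W x = w & forall t, W t *m A t = 0].
Proof.
move=> dA LA wA.
have dLA : derivable (fun t => L *m A t) x v.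
  by have [] := is_derive_mulmx (is_derive_cst L x v) (derivableP dA).
exists (fun t => \det (L *m A t) *: w - w *m A t *m \adj (L *m A t) *m L); split.
- have [d1 _] := is_derive_mulmx (is_derive_mulmx (is_derive_mulmx
    (is_derive_cst w x v) (derivableP dA)) (derivableP (derivable_adj dLA)))
    (is_derive_cst L x v).
  have d2 : derivable (fun t => \det (L *m A t) *: w) x v.
    apply/derivable_mxP => i j.
    rewrite (_ : (fun _ => _) = (fun t => \det (L *m A t)) * cst (w i j)).
      by apply: derivableM; [exact: derivable_det|exact: derivable_cst].
    by apply/funext => t; rewrite mxE.
  exact: derivableB d2 d1.
- by rewrite wA !mul0mx subr0 LA det1 scale1r.
- move=> t; rewrite mulmxBl -scalemxAl -!mulmxA mul_adj_mx mul_mx_scalar.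
  by rewrite -scalemxAr subrr.
Qed.

Lemma is_derive_line (f : V -> R) p u (c : R) df :
  is_derive (c *: u + p) u f df -> is_derive c 1 (fun s => f (s *: u + p)) df.
Proof.
move=> [df1 df2].
have E : (fun h : R => h^-1 *: (((fun s => f (s *: u + p)) \o shift c) (h *: 1) -
    f (c *: u + p))) = (fun h => h^-1 *: ((f \o shift (c *: u + p)) (h *: u) - f
      (c *: u + p))).
  by apply/funext => h /=; rewrite scalerDl addrA [h *: (1 : R)]mulr1.
by split; rewrite /derivable /derive E.
Qed.

(* The second difference is symmetric in [u] and [v]. *)
Let second_difference (f g : V -> R) x u v (e : R) : 0 < e ->
  (\forall y \near x, is_derive y u f (g y)) -> differentiable g x ->
  \forall h \near 0^'+,
    `|f (h *: u + (h *: v + x)) - f (h *: u + x) - f (h *: v + x) + f x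
      - h ^+ 2 * 'D_v g x| <= e * h ^+ 2.
Proof.
move=> e0 dfu dg.
(* Two remainders of the expansion of [g] occur, and this [M] bounds each of them by [e / 2 * h];
   the [+ 1] keeps [M] positive when [u] and [v] are zero. *)
pose M := 2 * (`|u| + `|v| + 1).
have M0 : 0 < M by rewrite mulr_gt0// ltr_wpDl// addr_ge0.
have eM : 0 < e / M by rewrite divr_gt0.
have near0 : \forall k \near (0 : V), is_derive (k + x) u f (g (k + x)) /\
    `|g (k + x) - g x - 'd g x k| <= e / M * `|k|.
  have [_ gE] := (diff_locallyxP _ _).1 dg.
  near=> k; split.
    near: k; move: dfu; rewrite (near_shift 0 x); apply: filterS => k /=.
    by rewrite subr0.
  rewrite gE -[X in `|X|]addrA -opprD addrC addKr.
  by near: k; apply: (littleoP [littleo of _]).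
have [r /= r0 rP] := (nbhs_ballP _ _).1 near0.
near=> h.
have h0 : 0 < h by [].
have hr0 : h * (`|u| + `|v|) < r.
  rewrite (@le_lt_trans _ _ (h * (`|u| + `|v| + 1)))//.
    by rewrite ler_wpM2l ?lerDl// ltW.
  rewrite -ltr_pdivlMr ?ltr_wpDl ?addr_ge0//; near: h.
  by apply: nbhs_right_lt; rewrite divr_gt0 ?ltr_wpDl ?addr_ge0.
have hr k : `|k| <= h * (`|u| + `|v|) -> is_derive (k + x) u f (g (k + x)) /\
    `|g (k + x) - g x - 'd g x k| <= e / M * `|k|.
  move=> kh; apply: rP; rewrite -ball_normE /ball_/= sub0r normrN.
  exact: le_lt_trans kh _.
(* The second difference is [phi h - phi 0]; the mean value theorem turns it into [h] times one
   difference of [g], which differentiability at [x] estimates. *)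
pose phi s := f (s *: u + (h *: v + x)) - f (s *: u + x).
pose dphi s := g (s *: u + (h *: v + x)) - g (s *: u + x).
have phi' s : s \in `[0, h] -> is_derive s 1 phi (dphi s).
  rewrite in_itv/= => /andP[s0 sh]; apply: is_deriveB; apply: is_derive_line.
    rewrite addrA; apply: (hr _ _).1.
    by rewrite (le_trans (ler_normD _ _))// !normrZ !ger0_norm ?(ltW h0)// mulrDr
      lerD2r ler_wpM2r.
  by apply: (hr _ _).1; rewrite normrZ ger0_norm// mulrDr ler_wpDr ?ler_wpM2r//
    mulr_ge0// ltW.
have [|c ch phiE] := MVT h0 (fun s sh => phi' s (subset_itv_oo_cc sh)).
  by apply: derivable_within_continuous => s /phi'[].
move: ch; rewrite in_itv/= => /andP[c0 ch].
have k1 : `|c *: u + h *: v| <= h * (`|u| + `|v|).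
  by rewrite (le_trans (ler_normD _ _))// !normrZ !gtr0_norm// mulrDr lerD2r
    ler_wpM2r// ltW.
have k2 : `|c *: u| <= h * (`|u| + `|v|).
  by rewrite normrZ gtr0_norm// mulrDr ler_wpDr ?ler_wpM2r ?(ltW ch)// mulr_ge0//
    ltW.
have [_ b1] := hr _ k1; have [_ b2] := hr _ k2.
have -> : f (h *: u + (h *: v + x)) - f (h *: u + x) - f (h *: v + x) + f x = phi
  h - phi 0.
  by rewrite /phi !scale0r !add0r; ring.
rewrite phiE /dphi subr0 addrA deriveE//.
have dE : 'd g x (c *: u + h *: v) = 'd g x (c *: u) + h * 'd g x v.
  by rewrite linearD; congr (_ + _); exact: linearZ.
rewrite dE in b1.
have eMk (k : V) : `|k| <= h * (`|u| + `|v|) -> e / M * `|k| <= e / 2 * h.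
  move=> kh; rewrite (le_trans (ler_wpM2l (ltW eM) kh))// [leRHS]mulrC mulrCA.
  have -> : e / 2 = e / M * (`|u| + `|v| + 1).
    by rewrite /M invfM mulrA divfK// gt_eqF// ltr_wpDl// addr_ge0.
  by rewrite ler_wpM2l ?(ltW h0)// ler_wpM2l ?(ltW eM)// lerDl.
rewrite (_ : _ - _ = h *
  (g (c *: u + h *: v + x) - g x - ('d g x (c *: u) + h * 'd g x v) -
  (g (c *: u + x) - g x - 'd g x (c *: u)))); last by ring.
rewrite normrM gtr0_norm// expr2 mulrCA ler_pM2l//.
rewrite (le_trans (ler_normB _ _))// (splitr e) mulrDl lerD//.
  exact: le_trans b1 (eMk _ k1).
exact: le_trans b2 (eMk _ k2).
Unshelve. all: by end_near.
Qed.

(** Young's form of the symmetry of second derivatives: one and the same second difference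
    approximates both [h ^+ 2 * 'D_v fu x] and [h ^+ 2 * 'D_u fv x]. *)
Lemma derive_comm (f fu fv : V -> R) x u v :
  (\forall y \near x, is_derive y u f (fu y)) ->
  (\forall y \near x, is_derive y v f (fv y)) ->
  differentiable fu x -> differentiable fv x -> 'D_u fv x = 'D_v fu x.
Proof.
move=> dfu dfv ddfu ddfv; apply/eqP; rewrite -subr_eq0 -normr_le0;
  apply/ler_addgt0Pl => e e0.
have e2 : 0 < e / 2 by rewrite divr_gt0.
have := second_difference v e2 dfu ddfu; have := second_difference u e2 dfv ddfv.
move=> B0 A0; have [h [[A B] h0]] :=
  filter_ex (filterI (filterI A0 B0) (nbhs_right_gt (0 : R))).
rewrite /= in A B; rewrite (addrCA (h *: v)) in B.
move: A B; move: (f _) (f _) (f _) (f _) ('D_v _ _) ('D_u _ _) => x1 x2 x3 x4 p q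
  A B.
have h2 : 0 < h ^+ 2 by rewrite exprn_gt0.
rewrite addr0 -(ler_pM2l h2) -[X in X * `|_|](gtr0_norm h2) -normrM.
rewrite (_ : h ^+ 2 * (q - p) = (x4 - x3 - x2 + x1 - h ^+ 2 * p) -
  (x4 - x2 - x3 + x1 - h ^+ 2 * q)); last by ring.
by rewrite (le_trans (ler_normB _ _))// [leRHS]mulrC (splitr e) mulrDl lerD.
Qed.
End Derivatives.

Section Jacobian.
Context {R : realType} {d n : nat}.
Implicit Types (f : 'rV[R]_d -> 'rV[R]_n) (x u v w : 'rV[R]_d).

Lemma derive_entry f x v j : derivable f x v ->
  'D_v f x 0 j = 'D_v (fun y => f y 0 j) x.
Proof. by move=> df; rewrite derive_mx// mxE. Qed.

Lemma differentiable_entry f x j : differentiable f x ->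
  differentiable (fun y => f y 0 j) x.
Proof.
move=> df.
exact: (@differentiable_comp _ _ _ _ f (fun N : 'rV[R]_n => N 0 j : R) x df
  (differentiable_coord _ _ _)).
Qed.

Lemma derive_comm_rV f x u v : (\forall y \near x, differentiable f y) ->
  (forall w, differentiable ('D_w f) x) ->
  'D_u ('D_v f) x = 'D_v ('D_u f) x.
Proof.
move=> df ddf; apply/rowP => j.
have near_entry w : \forall y \near x, is_derive y w (fun y => f y 0 j) ('D_w f y
  0 j).
  apply: filterS df => y dfy; rewrite derive_entry//; last exact: diff_derivable.
  by apply: derivableP; exact/diff_derivable/differentiable_entry.
apply: etrans (derive_entry j (diff_derivable (v := u) (ddf v))) _.
apply: etrans (esym (derive_entry j (diff_derivable (v := v) (ddf u)))).
exact: (derive_comm (near_entry u) (near_entry v) (differentiable_entry j (ddf u))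
  (differentiable_entry j (ddf v))).
Qed.

(** Entry (i, j) is the derivative of the j-th component along the i-th basis vector; symmetry lets
    the derivative along [v] be taken first. Hence the hessian appears below as a jacobian of
    ['D_v f]. *)
Lemma is_derive_jacobian f x v : (\forall y \near x, differentiable f y) ->
  (forall w, differentiable ('D_w f) x) ->
  is_derive x v (fun y => 'J f y) ('J ('D_v f) x).
Proof.
move=> df ddf.
have E i j : \forall y \near x, 'J f y i j = 'D_(delta_mx 0 i) f y 0 j.
  by apply: filterS df => y dfy; rewrite deriveEjacobian// -rowE [RHS]mxE.
have dE i j : is_derive x v (fun y => 'J f y i j) ('J ('D_v f) x i j).
  apply: (@near_eq_is_derive _ _ _ (fun y => 'D_(delta_mx 0 i) f y 0 j)).
    by apply: filterS (E i j) => y.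
  have dd := diff_derivable (v := v) (differentiable_entry j (ddf (delta_mx 0 i))).
  apply: DeriveDef => //.
  apply: etrans (esym (derive_entry j (diff_derivable (v := v) (ddf _)))) _.
  by rewrite derive_comm_rV// deriveEjacobian// -rowE [LHS]mxE.
have dJ : derivable (fun y => 'J f y) x v by apply/derivable_mxP => i j;
  exact: ex_derive.
apply: DeriveDef => //; rewrite derive_mx//; apply/matrixP => i j.
by rewrite mxE; exact: derive_val.
Qed.

End Jacobian.

Section MatrixDerivatives.
Context {R : realType} {V : normedModType R}.
Implicit Types (x v : V).

Lemma is_derive_mxP m n (F : V -> 'M[R]_(m, n)) x v dF :
  is_derive x v F dF <-> forall i j, is_derive x v (fun y => F y i j) (dF i j).
Proof.
split=> [[dFx <-] i j|dFij].
  apply: DeriveDef; first by move/derivable_mxP : dFx.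
  by rewrite derive_mx// mxE.
have dFx : derivable F x v by apply/derivable_mxP => i j; exact: ex_derive.
by apply: DeriveDef => //; rewrite derive_mx//; apply/matrixP => i j;
  rewrite mxE; exact: derive_val.
Qed.

Lemma is_derive_trmx m n (F : V -> 'M[R]_(m, n)) x v dF :
  is_derive x v F dF -> is_derive x v (fun y => (F y)^T) dF^T.
Proof.
move=> /is_derive_mxP dFx; apply/is_derive_mxP => i j; rewrite mxE.
by rewrite (_ : (fun _ => _) = fun y => F y j i)//; apply/funext => y; rewrite mxE.
Qed.

Lemma is_derive_scalemx m n (s : V -> R) (F : V -> 'M[R]_(m, n)) x v ds dF :
  is_derive x v s ds -> is_derive x v F dF ->
  is_derive x v (fun y => s y *: F y) (ds *: F x + s x *: dF).
Proof.
move=> dsx /is_derive_mxP dFx; apply/is_derive_mxP => i j.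
rewrite (_ : (fun _ => _) = s * (fun y => F y i j)); last first.
  by apply/funext => y; rewrite mxE.
apply: (is_derive_eq (is_deriveM dsx (dFx i j))).
by rewrite !mxE addrC; congr (_ + _); exact: mulrC.
Qed.

Lemma is_derive_near0 m n (F : V -> 'M[R]_(m, n)) x v (c dF : 'M[R]_(m, n)) :
  (\forall y \near x, F y = c) -> is_derive x v F dF -> dF = 0.
Proof.
move=> Fc [_ <-]; rewrite (near_eq_derive (g := cst c))//; exact: derive_cst.
Qed.

End MatrixDerivatives.

(** * A submersion in the affine chart: hessian, third derivative, contradiction *)

Section AffineSubmersion.
Context {R : realType} {d n : nat}.
Variables (e : R) (I J b : 'M[R]_d).
Hypothesis (ee : e * e = 1) (II : I *m I = - 1%:M) (JJ : J *m J = e%:M)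
  (JI : J *m I = - (I *m J)).
Hypotheses (bT : b^T = b) (bb : b *m b = 1%:M)
  (Ib : I *m b = - (b *m I^T)) (Jb : J *m b = - (b *m J^T)).

Local Notation N := (hyp_factor b).
Local Notation G := (proj_gram e I J b).
Local Notation P := (proj_cogram e I J b).

Lemma is_derive_mulmxr m (A : 'M[R]_(d, m)) (x v : 'rV[R]_d) :
  is_derive x v (fun y => y *m A) (v *m A).
Proof.
apply: is_derive_eq (is_derive_mulmx (is_derive_id x v) (is_derive_cst A x v)) _.
by rewrite mulmx0 addr0.
Qed.

Let form_sym (u v : 'rV[R]_d) : (u *m b *m v^T) 0 0 = (v *m b *m u^T) 0 0.
Proof.
by rewrite -[LHS]trace_mx11 -mxtrace_tr trace_mx11 !trmx_mul trmxK bT mulmxA.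
Qed.

Lemma is_derive_hyp_factor (x v : 'rV[R]_d) :
  is_derive x v N (- ((x *m b *m v^T) 0 0 *+ 2)).
Proof.
have /is_derive_mxP/(_ 0 0) h := is_derive_mulmx (is_derive_mulmxr b x v)
  (is_derive_trmx (is_derive_id x v)).
have := is_deriveB (is_derive_cst (1 : R) x v) h.
rewrite (_ : cst 1 - _ = N)// => dN; apply: (is_derive_eq dN).
by rewrite [X in _ - X]mxE sub0r form_sym mulr2n.
Qed.

Variable f : 'rV[R]_d -> 'rV[R]_n.
Variable O : set 'rV[R]_d.
Hypotheses (openO : open O) (fO : Cn_on 3 O f).
Hypothesis N0 : forall x, O x -> N x != 0.
Local Notation D x := ('J f x).
Hypothesis D_surj : forall x, O x -> forall w, exists u : 'rV_d, u *m D x = w.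
Hypotheses (kerI : forall x, O x -> forall u : 'rV_d, u *m D x = 0 ->
  u *m I *m D x = 0)
  (kerJ : forall x, O x -> forall u : 'rV_d, u *m D x = 0 -> u *m J *m D x = 0).
Local Notation normal x u :=
  (forall v : 'rV_d, v *m D x = 0 -> (u *m G x *m v^T) 0 0 = 0).
Hypothesis ker_nondeg : forall x, O x -> forall u : 'rV_d,
  u *m D x = 0 -> normal x u -> u = 0.
Variable g : 'rV[R]_n -> 'M[R]_n.
Hypothesis g_diff : forall x, O x -> forall i j, differentiable (fun y => g y i
  j) (f x).
Hypothesis submersion : forall x, O x -> forall u v : 'rV_d, normal x u ->
  normal x v ->
  (u *m D x *m g (f x) *m (v *m D x)^T) 0 0 = (u *m G x *m v^T) 0 0.

Local Notation S x w := ('J ('D_w f) x).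
Local Notation C x := ((D x)^T *m P x *m D x).

Let nearO x : O x -> \forall y \near x, O y.
Proof. by move=> Ox; exact: open_nbhs_nbhs. Qed.

Let df x : O x -> differentiable f x. Proof. by case: fO => + _; exact. Qed.
Let d2f x w : O x -> differentiable ('D_w f) x.
Proof. by case: fO => _ /(_ w)[+ _]; exact. Qed.
Let d3f x w v : O x -> differentiable ('D_v ('D_w f)) x.
Proof. by case: fO => _ /(_ w)[_ /(_ v)[+ _]]; exact. Qed.

Let dD x v : O x -> is_derive x v (fun y => D y) (S x v).
Proof.
move=> Ox; apply: is_derive_jacobian => [|w]; last exact: d2f.
by apply: filterS (nearO Ox) => y; exact: df.
Qed.

Let dS x v w : O x -> is_derive x v (fun y => S y w) ('J ('D_v ('D_w f)) x).
Proof.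
move=> Ox; apply: is_derive_jacobian => [|u]; last exact: d3f.
by apply: filterS (nearO Ox) => y; exact: d2f.
Qed.

Let SC x u v : O x -> u *m S x v = v *m S x u.
Proof.
move=> Ox; rewrite -!deriveEjacobian; [|exact: d2f..].
apply: derive_comm_rV => [|w]; last exact: d2f.
by apply: filterS (nearO Ox) => y; exact: df.
Qed.

Let right_inverse x : O x -> exists L : 'M[R]_(n, d), L *m D x = 1%:M.
Proof.
move=> Ox; have : row_full (D x).
  apply/row_fullP. 
  have hs i : {u : 'rV_d | u *m D x = delta_mx 0 i} by exact: cid (D_surj Ox _).
  exists (\matrix_i sval (hs i)); apply/row_matrixP => i.
  by rewrite row_mul rowK row1; exact: svalP (hs i).
by move=> /row_fullP.
Qed.

(* Differentiate [W y *m D y = 0] and [W y *m Q *m D y = 0] along [w], for a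
   field [W] of kernel vectors extending [u]. *)
Let S_descend x L Q : O x -> L *m D x = 1%:M ->
  (forall y, O y -> forall u : 'rV_d, u *m D y = 0 -> u *m Q *m D y = 0) ->
  forall w u : 'rV_d, u *m D x = 0 ->
  u *m Q *m S x w = u *m S x w *m (L *m Q *m D x).
Proof.
move=> Ox LD kerQ w u uD.
have [dDx _] := dD w Ox; have [W [dW Wx WD]] := kernel_field dDx LD uD.
have := is_derive_mulmx (derivableP dW) (dD w Ox).
move=> /(is_derive_near0 (nearW _ WD)) /eqP; rewrite addrC addr_eq0 Wx => /eqP uS.
have WQ : \forall y \near x, W y *m Q *m D y = 0.
  by apply: filterS (nearO Ox) => y Oy; exact: (kerQ y Oy (W y) (WD y)).
have := is_derive_mulmx (is_derive_mulmx (derivableP dW) (is_derive_cst Q x w))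
  (dD w Ox).
move=> /(is_derive_near0 WQ); rewrite mulmx0 addr0 Wx => /eqP.
rewrite addrC addr_eq0 => /eqP ->; rewrite uS mulNmx -!mulmxA.
by rewrite {1}(descend_mx LD (kerQ x Ox)) !mulmxA.
Qed.

(** The rows of Y = D^T P are normal vectors, because Y G = D^T, and [D] maps them to the rows of C.
    Isometry on them reads C g C = C. Moreover C is invertible: if c C = 0 then c Y is both vertical
    and normal, hence zero. *)
Let gram_inverse x : O x -> g (f x) *m C x = 1%:M.
Proof.
move=> Ox; have PG := proj_cogramK ee II JJ JI bT bb Ib Jb (N0 Ox).
have PT := proj_cogram_sym e I J bT x.
pose Y := (D x)^T *m P x.
have YG : Y *m G x = (D x)^T by rewrite /Y -mulmxA PG mulmx1.
have Ynormal (c : 'rV_n) : normal x (c *m Y).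
  by move=> v vD; rewrite -(mulmxA c) YG -mulmxA -trmx_mul vD linear0 mulmx0 mxE.
have CgC : C x *m g (f x) *m C x = C x.
  apply/matrixP => i j.
  have := submersion Ox (Ynormal (delta_mx 0 i)) (Ynormal (delta_mx 0 j)).
  have entry (X : 'M[R]_n) :
      ((delta_mx 0 i : 'rV[R]_n) *m X *m (delta_mx 0 j : 'rV[R]_n)^T) 0 0 = X i j.
    by rewrite trmx_delta -rowE -colE !mxE.
  have YD : Y *m D x = C x by [].
  have YT : Y^T = P x *m D x by rewrite /Y trmx_mul trmxK PT.
  have CT : (C x)^T = C x by rewrite !trmx_mul trmxK PT mulmxA.
  rewrite -!(mulmxA (delta_mx 0 _)) YG YD (trmx_mul _ (C x)) CT (trmx_mul _ Y) YT.
  rewrite -[(C x *m g (f x) *m C x) i j]entry -[C x i j]entry !mulmxA => ->.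
  by [].
have C_inj (c : 'rV_n) : c *m C x = 0 -> c = 0.
  move=> cC; have : c *m Y = 0.
    by apply: (ker_nondeg Ox); [rewrite -mulmxA|exact: Ynormal].
  move=> /(congr1 (mulmx^~ (G x))); rewrite mul0mx -mulmxA YG => cD.
  have [L LD] := right_inverse Ox.
  by rewrite -[c]mulmx1 -trmx1 -LD trmx_mul mulmxA cD mul0mx.
have Cu : C x \in unitmx.
  rewrite -row_free_unit -kermx_eq0; apply/eqP/row_matrixP => i; rewrite row0.
  by apply: C_inj; rewrite -row_mul mulmx_ker row0.
by rewrite -(mulKmx Cu (g (f x) *m C x)) (mulmxA (C x) (g (f x)) (C x)) CgC mulVmx.
Qed.

Let is_derive_outer (Q : 'M[R]_d) (x w : 'rV[R]_d) :
  is_derive x w (fun y => (y *m Q)^T *m (y *m Q))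
    ((w *m Q)^T *m (x *m Q) + (x *m Q)^T *m (w *m Q)).
Proof.
have h := is_derive_mulmxr Q x w.
exact: is_derive_mulmx (is_derive_trmx h) h.
Qed.

Let outer_ker x (Q : 'M[R]_d) (w : 'rV[R]_d) : w *m Q *m D x = 0 ->
  (D x)^T *m ((w *m Q)^T *m (x *m Q) + (x *m Q)^T *m (w *m Q)) *m D x = 0.
Proof.
move=> wQ; rewrite mulmxDr mulmxDl !(mulmxA _^T _^T) -!trmx_mul wQ linear0 !mul0mx.
by rewrite add0r -mulmxA wQ mulmx0.
Qed.

(** Each term of the derivative has a factor [w *m Q] with [Q] among 1, I, J, IJ, and these vectors
    are vertical together with [w]. *)
Let is_derive_quat_proj x w : O x -> w *m D x = 0 -> exists2 dM,
  is_derive x w (quat_proj e I J) dM & (D x)^T *m dM *m D x = 0.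
Proof.
move=> Ox wD.
have wI := kerI Ox wD; have wJ := kerJ Ox wD; have wK := kerJ Ox wI.
rewrite -(mulmxA w I J) in wK; rewrite -[w]mulmx1 in wD.
have h1 := is_derive_outer 1%:M x w; have hI := is_derive_outer I x w.
have hJ := is_derive_outer J x w; have hK := is_derive_outer (I *m J) x w.
have := is_deriveB (is_deriveB (is_deriveD h1 hI) (is_deriveZ e hJ)) (is_deriveZ
  e hK).
rewrite (_ : _ - _ = quat_proj e I J); last first.
  by apply/funext => y; rewrite quat_projE !fctE mulmx1.
move=> dM; eexists; first exact: dM.
have E (A1 A2 A3 A4 : 'M[R]_d) : (D x)^T *m (A1 + A2 - e *: A3 - e *: A4) *m D x =
    (D x)^T *m A1 *m D x + (D x)^T *m A2 *m D x - e *: ((D x)^T *m A3 *m D x)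
    - e *: ((D x)^T *m A4 *m D x).
  by rewrite !(mulmxDr, mulmxN) !(mulmxDl, mulNmx) -!scalemxAr -!scalemxAl.
by rewrite E !outer_ker// scaler0 !subr0 addr0.
Qed.

(** Minus half the logarithmic derivative of [N] along [w]. *)
Let lam (x w : 'rV[R]_d) := (x *m b *m w^T) 0 0 / N x.

(** Meant for A = D, B = S(w, .), Q = P: the cometric varies by a multiple of itself and a multiple
    of [dM], and the latter disappears between [A^T] and [A]. *)
Let gram_variation (Q dM : 'M[R]_d) (A B : 'M[R]_(d, n)) (c k : R) :
  A^T *m dM *m A = 0 ->
  (B^T *m Q + A^T *m (c *: Q + k *: - dM)) *m A + A^T *m Q *m B = 0 ->
  B^T *m Q *m A + A^T *m Q *m B = - c *: (A^T *m Q *m A).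
Proof.
move=> AdM; rewrite mulmxDl mulmxDr mulmxDl -!scalemxAr mulmxN -!scalemxAl mulNmx
  AdM.
by rewrite oppr0 scaler0 addr0 addrAC scaleNr => /eqP; rewrite addr_eq0 => /eqP.
Qed.

(** Along a vertical [w] the value of [f] is stationary, so differentiating [g (f y) *m C y = 1%:M]
    shows that C is stationary too; the right-hand side is what the factor [N] of the cometric
    contributes. *)
Let metric_hessian x w : O x -> w *m D x = 0 ->
  (S x w)^T *m P x *m D x + (D x)^T *m P x *m S x w = lam x w *+ 2 *: C x.
Proof.
move=> Ox wD; have [dM hM DMD] := is_derive_quat_proj Ox wD.
have gC := gram_inverse Ox; have Cg := mulmx1C gC.
have dfw : 'd f x w = 0.
  by have dfx := df Ox; rewrite -deriveE// deriveEjacobian.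
have dg : is_derive x w (fun y => g (f y)) 0.
  apply/is_derive_mxP => i j; rewrite mxE.
  have dgf : differentiable ((fun y => g y i j) \o f) x.
    by apply: differentiable_comp; [exact: df|exact: g_diff].
  rewrite (_ : (fun _ => _) = (fun y => g y i j) \o f)//.
  apply: DeriveDef; first exact: diff_derivable.
  rewrite deriveE// diff_comp; [|exact: df|exact: g_diff].
  by rewrite /= dfw linear0.
have hP := is_derive_scalemx (is_derive_hyp_factor x w) (is_deriveB
  (is_derive_cst b x w) hM).
have hD := dD w Ox.
have := is_derive_mulmx dg (is_derive_mulmx (is_derive_mulmx (is_derive_trmx hD)
  hP) hD).
have gC1 : \forall y \near x, g (f y) *m C y = 1%:M.
  by apply: filterS (nearO Ox) => y; exact: gram_inverse.
move=> /(is_derive_near0 gC1); rewrite mul0mx add0r.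
move=> /(congr1 (mulmx (C x))); rewrite mulmxA Cg mul1mx mulmx0.
have PE : N x *: (cst b - quat_proj e I J) x = P x by [].
have XE : (cst b - quat_proj e I J) x = (N x)^-1 *: P x.
  by rewrite -PE scalerA mulVf ?scale1r//; exact: N0.
rewrite PE XE scalerA sub0r => /(gram_variation DMD) ->.
by rewrite /lam mulNr opprK mulrnAl.
Qed.

(** Denominators are cleared so that the identity can be differentiated once more. *)
Let hessian_near0 x w : O x -> w *m D x = 0 ->
  N x *: S x w = (x *m b *m w^T) 0 0 *: D x
    - (x *m b *m (w *m I)^T) 0 0 *: (I *m D x)
    + (e * (x *m b *m (w *m J)^T) 0 0) *: (J *m D x)
    + (e * (x *m b *m (w *m (I *m J))^T) 0 0) *: (I *m J *m D x).
Proof.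
move=> Ox wD; have [L LD] := right_inverse Ox.
rewrite (hessian_formula ee II JJ JI LD (kerI Ox) (kerJ Ox)
  (fun u v => SC u v Ox) (S_descend Ox LD kerI) (S_descend Ox LD kerJ)
  (proj_cogram_skewI e II JI bb Ib x) (proj_cogram_skewJ I ee JJ bb Jb x)
  (gram_inverse Ox) (fun w => metric_hessian Ox) wD).
have N0x := N0 Ox.
rewrite !scalerDr scalerN !scalerA /lam.
by congr (_ *: _ - _ *: _ + _ *: _ + _ *: _);
  rewrite ?(mulrCA (N x) e) (mulrCA (N x)) mulfV// mulr1.
Qed.

Hypothesis O0 : O 0.

Let hyp_factor0 : N 0 = 1.
Proof. by rewrite /hyp_factor !mul0mx mxE subr0. Qed.

Let S0_ker w : w *m D 0 = 0 -> S 0 w = 0.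
Proof.
move=> wD; have := hessian_near0 O0 wD; rewrite hyp_factor0 scale1r !mul0mx mxE.
by rewrite !mulr0 !scale0r subr0 !addr0.
Qed.

(** The factor [y] vanishes at 0, so the derivative of [W] does not contribute. *)
Let is_derive_form (W : 'rV[R]_d -> 'rV[R]_d) v (Q : 'M[R]_d) : derivable W 0 v ->
  is_derive 0 v (fun y => (y *m b *m (W y *m Q)^T) 0 0) ((v *m b *m (W 0 *m Q)^T)
    0 0).
Proof.
move=> dW.
have h := is_derive_trmx (is_derive_mulmx (derivableP dW) (is_derive_cst Q 0 v)).
have /is_derive_mxP/(_ 0 0) h' := is_derive_mulmx (is_derive_mulmxr b 0 v) h.
by apply: (is_derive_eq h'); rewrite !mul0mx addr0.
Qed.

Let is_derive_form_scale (k : 'rV[R]_d -> R) v dk (A : 'M[R]_(1, d)) :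
  is_derive 0 v k dk -> k 0 = 0 ->
  is_derive 0 v (fun y => k y *: (A *m D y)) (dk *: (A *m D 0)).
Proof.
move=> hk k0.
apply: (is_derive_eq (is_derive_scalemx hk (is_derive_mulmx (is_derive_cst A 0 v)
  (dD v O0)))).
by rewrite k0 scale0r addr0.
Qed.

(* Differentiate [hessian_near0] at 0 along [v], with [w] extended to a field
   of kernel vectors. *)
Let third_derivative v w Y : w *m D 0 = 0 ->
  w *m 'J ('D_v ('D_Y f)) 0 =
    (v *m b *m w^T) 0 0 *: (Y *m D 0)
    - (v *m b *m (w *m I)^T) 0 0 *: (Y *m I *m D 0)
    + (e * (v *m b *m (w *m J)^T) 0 0) *: (Y *m J *m D 0)
    + (e * (v *m b *m (w *m (I *m J))^T) 0 0) *: (Y *m (I *m J) *m D 0).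
Proof.
move=> wD; have [L LD] := right_inverse O0; have [dD0 _] := dD v O0.
have [W [dW W0 WD]] := kernel_field dD0 LD wD.
(* As S(w, .) vanishes at 0, the derivative of the field is again vertical there, and by symmetry
   its product with the hessian along [Y] is zero. *)
have W'D : 'D_v W 0 *m D 0 = 0.
  have := is_derive_mulmx (derivableP dW) (dD v O0).
  move=> /(is_derive_near0 (nearW _ WD));
    rewrite W0 (SC _ _ O0) S0_ker// mulmx0 addr0.
  by [].
pose k Q y := (y *m b *m (W y *m Q)^T) 0 0.
have k0 Q : k Q 0 = 0 by rewrite /k !mul0mx mxE.
have dk Q : is_derive 0 v (k Q) ((v *m b *m (w *m Q)^T) 0 0).
  by rewrite -W0; exact: is_derive_form.
have dek Q : is_derive 0 v (fun y => e * k Q y) (e * (v *m b *m (w *m Q)^T) 0 0).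
  exact: is_deriveZ.
have ek0 Q : e * k Q 0 = 0 by rewrite k0 mulr0.
have R1 := is_derive_form_scale (Y *m 1%:M) (dk 1%:M) (k0 _).
have R2 := is_derive_form_scale (Y *m I) (dk I) (k0 _).
have R3 := is_derive_form_scale (Y *m J) (dek J) (ek0 _).
have R4 := is_derive_form_scale (Y *m (I *m J)) (dek (I *m J)) (ek0 _).
have RHS := is_deriveD (is_deriveD (is_deriveB R1 R2) R3) R4.
have LHS := is_derive_scalemx (is_derive_hyp_factor 0 v)
  (is_derive_mulmx (derivableP dW) (dS v Y O0)).
have := is_deriveB LHS RHS.
set F := (X in is_derive 0 v X _) => dF.
have F0 : \forall y \near (0 : 'rV[R]_d), F y = 0.
  apply: filterS (nearO O0) => y Oy; apply/eqP; rewrite subr_eq0; apply/eqP.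
  rewrite !fctE SC// scalemxAr (hessian_near0 Oy (WD y)) !(mulmxDr, mulmxN).
  by rewrite -!scalemxAr /k !mulmx1 !mulmxA.
move: dF => /(is_derive_near0 F0) /eqP; rewrite subr_eq0 => /eqP.
rewrite !mul0mx mxE mul0rn oppr0 scale0r add0r hyp_factor0 scale1r W0.
by rewrite (SC _ _ O0) (S0_ker W'D) mulmx0 add0r !mulmx1 => ->.
Qed.

(** By polarization a kernel of null vectors would be normal to itself for G(0) = b, against
    non-degeneracy; it is non-zero by dimension. *)
Let exists_nonnull : (n < d)%N -> exists2 w : 'rV[R]_d, w *m D 0 = 0 & (w *m b *m
  w^T) 0 0 != 0.
Proof.
move=> nd; apply: contrapT => null.
have kernull (u : 'rV[R]_d) : u *m D 0 = 0 -> (u *m b *m u^T) 0 0 = 0.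
  by move=> uD; apply/eqP/negPn/negP => nz; apply: null; exists u.
have : kermx (D 0) != 0.
  by rewrite kermx_eq0 /row_free neq_ltn (leq_ltn_trans (rank_leq_col _)).
case/negP; apply/eqP/row_matrixP => i; rewrite row0.
have uD : row i (kermx (D 0)) *m D 0 = 0 by rewrite -row_mul mulmx_ker row0.
apply: (ker_nondeg O0 uD) => v vD.
have -> : G 0 = b.
  rewrite /proj_gram hyp_factor0 invr1 !scale1r quat_projE !mul0mx !mulmx0.
  by rewrite !scaler0 !subr0 !addr0 mulmx0 mul0mx addr0.
have := kernull (row i (kermx (D 0)) + v);
  rewrite mulmxDl uD vD addr0 => /(_ erefl).
rewrite linearD/= !mulmxDl !mulmxDr !mxE;
  move: (kernull _ uD) (kernull _ vD) (form_sym v (row i (kermx (D 0)))).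
rewrite !mxE => -> -> ->; rewrite add0r addr0 -mulr2n => /eqP.
by rewrite mulrn_eq0 => /eqP.
Qed.

Theorem no_quaternionic_submersion : (0 < n < d)%N -> False.
Proof.
move=> /andP[n0 /exists_nonnull[w wD wnull]].
(* Any non-zero image would do; with all entries 1, the comparison at the end can be made at the
   entry of index 0. *)
have [Y YD] := D_surj O0 (const_mx 1).
have Kb : I *m J *m b = - (b *m (I *m J)^T).
  by rewrite -mulmxA Jb mulmxN mulmxA Ib mulNmx opprK -mulmxA -trmx_mul JI
    linearN mulmxN.
have skew0 Q : Q *m b = - (b *m Q^T) -> (w *m b *m (w *m Q)^T) 0 0 = 0.
  by move=> Qb; rewrite form_sym skew_form_eq0.
(* The two orders of differentiation give [<w, w> D_Y f] and 0. *)
have T1 : w *m 'J ('D_w ('D_Y f)) 0 = (w *m b *m w^T) 0 0 *: const_mx 1.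
  rewrite third_derivative// (skew0 _ Ib) (skew0 _ Jb) (skew0 _ Kb).
  by rewrite !mulr0 !scale0r subr0 !addr0 YD.
have T2 : w *m 'J ('D_Y ('D_w f)) 0 = 0.
  rewrite third_derivative// wD (kerI O0 wD) (kerJ O0 wD) (mulmxA w I J).
  by rewrite (kerJ O0 (kerI O0 wD)) !scaler0 subr0 !addr0.
have E : 'D_w ('D_Y ('D_w f)) 0 = 'D_w ('D_w ('D_Y f)) 0.
  apply: near_eq_derive; apply: filterS (nearO O0) => y Oy.
  apply: derive_comm_rV => [|u]; last exact: d2f.
  by apply: filterS (nearO Oy) => z; exact: df.
have T1' := etrans (deriveEjacobian w (d3f Y w O0)) T1.
have T2' := etrans (deriveEjacobian w (d3f w Y O0)) T2.
have := etrans (esym T2') (etrans E T1').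
move=> /matrixP/(_ 0 (Ordinal n0)); rewrite [LHS]mxE [RHS]mxE [const_mx _ _ _]mxE
  mulr1 => /esym/eqP.
by rewrite (negPf wnull).
Qed.

End AffineSubmersion.

(** * Right multiplication by (para-)quaternions as real matrices *)

Section QuaternionMatrices.
Variables (R : realType) (e : R).
Hypothesis ee : e * e = 1.
Implicit Types (p q c : 'rV[R]_4).

Definition rmul c : 'M[R]_4 := \matrix_(k < 4) qmul e (delta_mx 0 k) c.

Definition qI : 'rV[R]_4 := mkquat 0 1 0 0.
Definition qJ : 'rV[R]_4 := mkquat 0 0 1 0.

Lemma sum4 (V : nmodType) (F : 'I_4 -> V) : \sum_k F k = F 0 + F 1 + F 2 + F 3.
Proof.
rewrite !big_ord_recl big_ord0 addr0 !addrA.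
by congr (F _ + F _ + F _ + F _); exact: val_inj.
Qed.

Lemma rmulE p c : p *m rmul c = qmul e p c.
Proof.
by apply: quatP; rewrite mxE sum4 !mxE !eqE /=; ring.
Qed.

Lemma rmulM c c' : rmul c *m rmul c' = rmul (qmul e c c').
Proof. by apply/row_matrixP => k; rewrite !rowE !mulmxA !rmulE qmulA. Qed.

Lemma rmul1 a : rmul (a *: qone R) = a%:M.
Proof.
apply/row_matrixP => k; rewrite !rowE rmulE mul_mx_scalar.
by apply: quatP; rewrite !mxE /=; ring.
Qed.

Lemma rmul_one : rmul (qone R) = 1%:M.
Proof. by rewrite -[qone R]scale1r rmul1. Qed.

Definition qform p q : R := qre (qmul e p (qconj q)).

Lemma qformE p q : qform p q = (p *m quat_form e *m q^T) 0 0.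
Proof.
by rewrite /qform /qre mul_mx_diag [RHS]mxE sum4 !mxE /=; ring.
Qed.

Lemma qform_adj p q c : qform (qmul e p c) q = qform p (qmul e q (qconj c)).
Proof. by rewrite /qform qconjM qconjK qmulA. Qed.

Lemma quat_form2 : quat_form e *m quat_form e = 1%:M.
Proof.
rewrite mulmx_diag -[RHS]diag_const_mx; congr diag_mx; apply/rowP => k;
  rewrite !mxE.
by case: k => [[|[|[|[|]]]]]//= _; rewrite ?mulr1 ?mulrNN.
Qed.

Lemma qform_nondeg p : (forall q, qform p q = 0) -> p = 0.
Proof.
move=> p0; apply/rowP => k; rewrite mxE.
have := p0 (delta_mx 0 k *m quat_form e).
rewrite qformE trmx_mul tr_diag_mx !mulmxA -(mulmxA p) quat_form2 mulmx1.
by rewrite trmx_delta -colE mxE.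
Qed.

Lemma qmul_conj p : qmul e p (qconj p) = qnorm e p *: qone R.
Proof. by apply: quatP; rewrite /qnorm /qre !mxE /=; ring. Qed.

Lemma qnormM p q : qnorm e (qmul e p q) = qnorm e p * qnorm e q.
Proof.
rewrite {1}/qnorm qconjM -qmulA (qmulA e q) qmul_conj.
by move: (qnorm e q) => k; rewrite /qnorm /qre !mxE /=; ring.
Qed.

Lemma qnormZ a p : qnorm e (a *: p) = a ^+ 2 * qnorm e p.
Proof. by rewrite /qnorm /qre !mxE /=; ring. Qed.

Lemma qnorm1 : qnorm e (qone R) = 1.
Proof. by rewrite /qnorm /qre !mxE /=; ring. Qed.

Lemma qmulZr a p q : qmul e p (a *: q) = a *: qmul e p q.
Proof. by apply: quatP; rewrite !mxE /=; ring. Qed.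

Lemma qmulqV p : qnorm e p != 0 -> qmul e p (qinv e p) = qone R.
Proof. by move=> p0; rewrite /qinv qmulZr qmul_conj scalerA mulVf// scale1r. Qed.

Lemma qinv_mulq p : qnorm e p != 0 -> qmul e (qinv e p) p = qone R.
Proof.
move=> p0; rewrite -[LHS]rmulE /qinv -scalemxAl rmulE qmulVq qmul_conj scalerA.
by rewrite mulVf// scale1r.
Qed.

Variable m : nat.

Definition Rmul c : 'M[R]_(m * 4) := lin_mx (@mulmxr R m 4 4 (rmul c)).

Lemma RmulE (X : 'M[R]_(m, 4)) c : mxvec X *m Rmul c = mxvec (X *m rmul c).
Proof. by rewrite mul_vec_lin. Qed.

Lemma mx_form_eq d (A B : 'M[R]_d) :
  (forall u v : 'rV_d, (u *m A *m v^T) 0 0 = (u *m B *m v^T) 0 0) -> A = B.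
Proof.
move=> AB; apply/matrixP => i j; have := AB (delta_mx 0 i) (delta_mx 0 j).
by rewrite trmx_delta -!rowE -!colE !mxE.
Qed.

Lemma RmulM c c' : Rmul c *m Rmul c' = Rmul (qmul e c c').
Proof.
apply/row_matrixP => k; rewrite !rowE; move: (delta_mx _ _) => u.
by rewrite -[u]vec_mxK mulmxA !RmulE -mulmxA rmulM.
Qed.

Lemma Rmul_scalar a : Rmul (a *: qone R) = a%:M.
Proof.
apply/row_matrixP => k; rewrite !rowE; move: (delta_mx _ _) => u.
by rewrite -[u]vec_mxK RmulE rmul1 !mul_mx_scalar linearZ.
Qed.

Lemma Rmul_II : Rmul qI *m Rmul qI = - 1%:M.
Proof.
have -> : - 1%:M = (- 1)%:M :> 'M[R]_(m * 4) by rewrite raddfN.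
rewrite RmulM -Rmul_scalar; congr Rmul.
by apply: quatP; rewrite !mxE /=; ring.
Qed.

Lemma Rmul_JJ : Rmul qJ *m Rmul qJ = e%:M.
Proof.
rewrite RmulM -Rmul_scalar; congr Rmul.
by apply: quatP; rewrite !mxE /=; ring.
Qed.

Lemma RmulN c : Rmul (- c) = - Rmul c.
Proof.
apply/row_matrixP => k; rewrite !rowE; move: (delta_mx _ _) => u.
rewrite mulmxN -[u]vec_mxK !RmulE -linearN/= -mulmxN; congr (mxvec (_ *m _)).
by apply/matrixP => i j; rewrite !mxE; case: j => [[|[|[|[|]]]]]//= ?; ring.
Qed.

Lemma Rmul_JI : Rmul qJ *m Rmul qI = - (Rmul qI *m Rmul qJ).
Proof.
by rewrite !RmulM -RmulN; congr Rmul; apply: quatP; rewrite !mxE /=; ring.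
Qed.

(* [eta j] is the sign of the homogeneous coordinate number [j.+1]. *)
Variable eta : 'I_m -> R.
Hypothesis eta2 : forall j, eta j * eta j = 1.

Definition sform (X Y : 'M[R]_(m, 4)) : R :=
  \sum_j eta j * qform (row j X) (row j Y).

Definition flat_gram : 'M[R]_(m * 4) :=
  diag_mx (mxvec (\matrix_(j < m, k < 4) (eta j * [:: 1; 1; - e; - e]`_k))).

Lemma flat_gramE X Y : (mxvec X *m flat_gram *m (mxvec Y)^T) 0 0 = sform X Y.
Proof.
rewrite mul_mx_diag mxE (reindex _ (curry_mxvec_bij _ _))/=.
rewrite (eq_bigr (fun p : 'I_m * 'I_4 => eta p.1 * (X p.1 p.2 *
  [:: 1; 1; - e; - e]`_p.2 * Y p.1 p.2))).
  rewrite -(pair_bigA _ (fun j k => eta j * (X j k * [:: 1; 1; - e; - e]`_k * Y j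
    k)))/=.
  apply: eq_bigr => j _; rewrite -big_distrr/=; congr (_ * _).
  rewrite qformE mul_mx_diag mxE; apply: eq_bigr => k _.
  by rewrite !mxE.
by move=> [j k] _; rewrite !mxE !mxvecE mxE; ring.
Qed.

Lemma flat_gramT : flat_gram^T = flat_gram. Proof. exact: tr_diag_mx. Qed.

Lemma flat_gram2 : flat_gram *m flat_gram = 1%:M.
Proof.
rewrite mulmx_diag -[RHS]diag_const_mx; congr diag_mx; apply/rowP => k.
case/mxvec_indexP: k => j k; rewrite mxE !mxvecE !mxE mulrACA eta2 mul1r.
by case: k => [[|[|[|[|]]]]]//= _; rewrite ?mulr1 ?mulrNN.
Qed.

Lemma sform_adj X Y c : sform (X *m rmul c) Y = sform X (Y *m rmul (qconj c)).
Proof. by apply: eq_bigr => j _; rewrite !row_mul !rmulE qform_adj. Qed.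

(** The adjoint of right multiplication by [c] is right multiplication by its conjugate. *)
Lemma Rmul_flat_gram c : qconj c = - c ->
  Rmul c *m flat_gram = - (flat_gram *m (Rmul c)^T).
Proof.
move=> cc; apply: mx_form_eq => u v; rewrite -[u]vec_mxK -[v]vec_mxK.
rewrite mulmxA RmulE flat_gramE sform_adj cc -flat_gramE -RmulE RmulN.
rewrite mulmxN [(- _)^T]linearN /= !mulmxN mulNmx [LHS]mxE [RHS]mxE.
by rewrite trmx_mul !mulmxA.
Qed.

Lemma Rmul_flat_gramI : Rmul qI *m flat_gram = - (flat_gram *m (Rmul qI)^T).
Proof. by apply: Rmul_flat_gram; apply: quatP; rewrite !mxE /=; ring. Qed.

Lemma Rmul_flat_gramJ : Rmul qJ *m flat_gram = - (flat_gram *m (Rmul qJ)^T).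
Proof. by apply: Rmul_flat_gram; apply: quatP; rewrite !mxE /=; ring. Qed.

(** Translates products with [quat_frame], in which the metric is written, into right
    multiplication. *)
Lemma frameE (X : 'M[R]_(m, 4)) c :
  c *m quat_frame (Rmul qI) (Rmul qJ) (mxvec X) = mxvec (X *m rmul c).
Proof.
rewrite mulmx_sum_row sum4 !rowK/= mulmx1 mulmxA !RmulE -!linearZ -!linearD/=;
  congr mxvec.
apply/row_matrixP => j.
rewrite !linearD/= !linearZ/= !row_mul !rmulE; move: (row j X) => p.
by apply: quatP; rewrite !mxE /=; ring.
Qed.

End QuaternionMatrices.

Lemma differentiable_mx (R : realType) (V : normedModType R) m n (F : V ->
  'M[R]_(m, n)) x :
  (forall i j, differentiable (fun y => F y i j) x) -> differentiable F x.
Proof.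
move=> dF; rewrite (_ : F = \sum_(i < m) \sum_(j < n) (fun y => F y i j *:
  delta_mx i j)).
  by apply: differentiable_sum => i; apply: differentiable_sum => j;
    apply: differentiableZl.
apply/funext => y; rewrite [LHS]matrix_sum_delta fct_sumE; apply: eq_bigr => i _.
by rewrite fct_sumE.
Qed.

(** * Horizontal lifts, metric and structure in the affine chart number 0 *)

Section AffineChart.
Variables (R : realType) (e : R) (m t : nat).
Hypothesis ee : e * e = 1.
Local Notation vec := 'M[R]_(m.+1, 4).
Implicit Types (z W : vec) (X Y : 'M[R]_(m, 4)) (p q c s : 'rV[R]_4).

Definition row_sign (j : 'I_m) : R := if (lift ord0 j <= t)%N then -1 else 1.

Lemma row_sign2 j : row_sign j * row_sign j = 1.
Proof. by rewrite /row_sign; case: ifP => _; rewrite ?mulrNN mulr1. Qed.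

Definition cons_vec q X : vec := \matrix_(a, k) if unlift ord0 a is Some j then X
  j k else q 0 k.

Lemma row_cons_vec0 q X : row 0 (cons_vec q X) = q.
Proof. by apply/rowP => k; rewrite !mxE unlift_none. Qed.

Lemma row'_cons_vec q X : row' 0 (cons_vec q X) = X.
Proof. by apply/matrixP => j k; rewrite !mxE liftK. Qed.

Lemma cons_vecE z : z = cons_vec (row 0 z) (row' 0 z).
Proof.
by apply/matrixP => a k; rewrite !mxE; case: unliftP => [j ->|->]; rewrite ?mxE.
Qed.

Lemma cons_vecD p q X Y : cons_vec p X + cons_vec q Y = cons_vec (p + q) (X + Y).
Proof.
by apply/matrixP => a k; rewrite !mxE; case: (unlift _ _) => *; rewrite ?mxE.
Qed.

Lemma cons_vecB p q X Y : cons_vec p X - cons_vec q Y = cons_vec (p - q) (X - Y).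
Proof.
by apply/matrixP => a k; rewrite !mxE; case: (unlift _ _) => *; rewrite ?mxE.
Qed.

Lemma rscaleE z c : rscale e z c = z *m rmul e c.
Proof. by apply/row_matrixP => a; rewrite rowK row_mul rmulE. Qed.

Lemma rscale_cons q X c : rscale e (cons_vec q X) c = cons_vec (qmul e q c) (X *m
  rmul e c).
Proof.
rewrite [LHS]cons_vecE rscaleE; congr cons_vec;
  first by rewrite row_mul row_cons_vec0 rmulE.
by rewrite -[in RHS](row'_cons_vec q X); apply/matrixP => j k; rewrite !mxE;
  apply: eq_bigr => l _; rewrite !mxE.
Qed.

Local Notation qform := (qform e).
Local Notation sform := (sform e row_sign).

Lemma qinner_cons p q X Y : qinner e t (cons_vec p X) (cons_vec q Y) = - qform p
  q + sform X Y.
Proof.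
rewrite /qinner big_ord_recl leq0n !row_cons_vec0 mulN1r; congr (_ + _).
apply: eq_bigr => j _; rewrite /row_sign; congr (_ * qre (qmul _ _ (qconj _))).
  by rewrite -[in RHS](row'_cons_vec p X); apply/rowP => k; rewrite !mxE.
by rewrite -[in RHS](row'_cons_vec q Y); apply/rowP => k; rewrite !mxE.
Qed.

Lemma affine0E z : affine e 0 z = mxvec (row' 0 z *m rmul e (qinv e (row 0 z))).
Proof.
congr mxvec; apply/row_matrixP => j; rewrite rowK row_mul rmulE; congr qmul.
by apply/rowP => k; rewrite !mxE.
Qed.

Lemma affine_tail z : qnorm e (row 0 z) != 0 ->
  vec_mx (affine e 0 z) *m rmul e (row 0 z) = row' 0 z.
Proof.
move=> z0; rewrite affine0E mxvecK -mulmxA rmulM qinv_mulq// .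
by rewrite rmul_one mulmx1.
Qed.

Lemma rmul_sum c : rmul e c = \sum_(i < 4) c 0 i *: rmul e (delta_mx 0 i).
Proof.
apply/row_matrixP => k; rewrite rowE rmulE linear_sum/=.
under eq_bigr do rewrite linearZ/= rowE rmulE.
move: (delta_mx 0 k) => p; rewrite sum4.
by apply: quatP; rewrite !mxE !eqE /=; ring.
Qed.

Lemma differentiable_qnorm_row z : differentiable (fun w : vec => qnorm e (row 0
  w)) z.
Proof.
have coord a k : differentiable (fun w : vec => w a k) z by exact:
  differentiable_coord.
rewrite (_ : (fun _ => _) = (fun w : vec => w 0 0) * (fun w => w 0 0) +
   (fun w => w 0 1) * (fun w => w 0 1) -
   e *: ((fun w => w 0 2) * (fun w => w 0 2)) - e *: ((fun w => w 0 3) * (fun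
     w => w 0 3))).
  apply: differentiableB; [apply: differentiableB; [apply: differentiableD|]|];
    by repeat (apply: differentiableZ || apply: differentiableM).
by apply/funext => w; rewrite /qnorm /qre !mxE !fctE /=/GRing.scale/=; ring.
Qed.

Lemma differentiable_affine z : qnorm e (row 0 z) != 0 ->
  differentiable (affine e 0) z.
Proof.
move=> z0.
have coord a k : differentiable (fun w : vec => w a k) z by exact:
  differentiable_coord.
have dnorm := differentiable_qnorm_row z.
have dconj i : differentiable (fun w : vec => qconj (row 0 w) 0 i) z.
  case: i => [[|[|[|[|]]]]]//= ?.
  - by rewrite (_ : (fun _ => _) = (fun w : vec => w 0 0))//; apply/funext => w;
    rewrite !mxE.
  - rewrite (_ : (fun _ => _) = - (fun w : vec => w 0 1));
    first exact: differentiableN.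
    by apply/funext => w; rewrite !mxE.
  - rewrite (_ : (fun _ => _) = - (fun w : vec => w 0 2));
    first exact: differentiableN.
    by apply/funext => w; rewrite !mxE.
  - rewrite (_ : (fun _ => _) = - (fun w : vec => w 0 3));
    first exact: differentiableN.
    by apply/funext => w; rewrite !mxE.
apply: differentiable_mx => i; case/mxvec_indexP => j k; rewrite ord1.
rewrite (_ : (fun _ => _) = \sum_(l < 4) \sum_(i < 4) ((fun w : vec => w (lift
  ord0 j) l) *
  (((fun w : vec => (qnorm e (row 0 w))^-1) * (fun w : vec => qconj (row 0 w) 0
    i)) *
   cst (rmul e (delta_mx 0 i) l k)))); last first.
  apply/funext => w; rewrite affine0E mxvecE mxE fct_sumE; apply: eq_bigr => l _.
  rewrite fct_sumE mxE rmul_sum summxE mulr_sumr; apply: eq_bigr => i' _.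
  by rewrite /qinv [X in _ * X = _]mxE [X in _ * (X * _) = _]mxE.
apply: differentiable_sum => l; apply: differentiable_sum => i'.
apply: differentiableM => //; apply: differentiableM;
  last exact: differentiable_cst.
by apply: differentiableM => //; exact: differentiableV.
Qed.

Lemma diff_affine q X W : qnorm e q != 0 ->
  'd (affine e 0) (cons_vec q (X *m rmul e q)) W =
    mxvec ((row' 0 W - X *m rmul e (row 0 W)) *m rmul e (qinv e q)).
Proof.
move=> q0; set z := cons_vec _ _.
have zq : row 0 z = q by exact: row_cons_vec0.
have dA : differentiable (affine e 0) z by apply: differentiable_affine; rewrite zq.
have Az : affine e 0 z = mxvec X.
  rewrite affine0E row'_cons_vec row_cons_vec0 -mulmxA rmulM qmulqV//.
  by rewrite rmul_one mulmx1.
rewrite -deriveE//; set dW := 'D_W _ z.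
have hA : is_derive z W (affine e 0) dW by apply: derivableP; exact: diff_derivable.
have hV : is_derive z W (fun w => vec_mx (affine e 0 w)) (vec_mx dW).
  apply/is_derive_mxP => j k; move/is_derive_mxP: hA => /(_ 0 (mxvec_index j k)).
  rewrite mxE; congr (is_derive z W _ _); apply/funext => w; by rewrite mxE.
have hc a k : is_derive z W (fun w : vec => w a k) (W a k).
  by move: a k; apply/is_derive_mxP; exact: is_derive_id.
have hR : is_derive z W (fun w : vec => rmul e (row 0 w)) (rmul e (row 0 W)).
  apply/is_derive_mxP => l k.
  rewrite (_ : (fun _ => _) = \sum_(i < 4) (rmul e (delta_mx 0 i) l k *: (fun w :
    vec => w 0 i))).
    have h i := is_deriveZ (rmul e (delta_mx 0 i) l k) (hc 0 i).
    apply: (is_derive_eq (is_derive_sum h)).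
    rewrite rmul_sum summxE; apply: eq_bigr => i _; rewrite !mxE; exact: mulrC.
  apply/funext => w; rewrite rmul_sum summxE fct_sumE; apply: eq_bigr => i _.
  rewrite !mxE; exact: mulrC.
have hT : is_derive z W (fun w : vec => row' 0 w) (row' 0 W).
  apply/is_derive_mxP => j k; rewrite mxE.
  by rewrite (_ : (fun _ => _) = (fun w : vec => w (lift 0 j) k))//;
    apply/funext => w; rewrite mxE.
have := is_deriveB (is_derive_mulmx hV hR) hT.
have near0 : \forall w \near z, vec_mx (affine e 0 w) *m rmul e (row 0 w) - row'
  0 w = 0.
  have zn : qnorm e (row 0 z) != 0 by rewrite zq.
  have : \forall w \near z, qnorm e (row 0 w) != 0.
    have := differentiable_continuous (differentiable_qnorm_row z).
    by move=> /cvgr_neq0 /(_ zn).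
  by apply: filterS => w w0; rewrite affine_tail// subrr.
move=> /(is_derive_near0 near0) /eqP; rewrite subr_eq0 Az mxvecK zq => /eqP <-.
rewrite addrK -mulmxA rmulM qmulqV// rmul_one mulmx1 vec_mxK.
by [].
Qed.

Local Notation b := (flat_gram e row_sign).
Local Notation Ri := (Rmul e m (qI R)).
Local Notation Rj := (Rmul e m (qJ R)).
Local Notation N x := (hyp_factor b x).
Local Notation Z x := (quat_frame Ri Rj x).
Local Notation G x := (proj_gram e Ri Rj b x).

Let bT := flat_gramT e row_sign.
Let bb := flat_gram2 ee row_sign2.
Let Ib := Rmul_flat_gramI e row_sign.
Let Jb := Rmul_flat_gramJ e row_sign.
Let II := Rmul_II e m.
Let JJ := Rmul_JJ e m.
Let JI := Rmul_JI e m.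

Lemma hyp_factorE X : N (mxvec X) = 1 - sform X X.
Proof. by rewrite /hyp_factor flat_gramE. Qed.

Lemma sform_frame X p q :
  sform (X *m rmul e p) (X *m rmul e q) = (1 - N (mxvec X)) * qform p q.
Proof.
rewrite -flat_gramE -!frameE trmx_mul !mulmxA -2!(mulmxA p).
rewrite (quat_frame_gram II JJ JI bT Ib Jb) -scalemxAr -scalemxAl mxE.
by rewrite qformE.
Qed.

(* The horizontal vector at [cons_vec 1 X] over the tangent vector U is
   [(h, U + X h)], h being the hermitian product of X and U divided by N. *)
Definition lift_coef X (U : 'M[R]_(m, 4)) : 'rV[R]_4 :=
  (N (mxvec X))^-1 *: (mxvec U *m b *m (Z (mxvec X))^T *m quat_form e).

Definition lift_vec X U : vec := cons_vec (lift_coef X U) (U + X *m rmul e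
  (lift_coef X U)).

Lemma sform_lift_coef X U c : N (mxvec X) != 0 ->
  sform U (X *m rmul e c) = N (mxvec X) * qform (lift_coef X U) c.
Proof.
move=> N0; rewrite qformE /lift_coef -!scalemxAl mxE mulrA mulfV// mul1r.
rewrite -(mulmxA _ (quat_form e) (quat_form e)) quat_form2// mulmx1.
by rewrite -flat_gramE -frameE trmx_mul !mulmxA.
Qed.

Lemma sformDl X Y U : sform (X + Y) U = sform X U + sform Y U.
Proof. by rewrite -!flat_gramE linearD/= !mulmxDl mxE. Qed.

Lemma sformDr X Y U : sform U (X + Y) = sform U X + sform U Y.
Proof.
by rewrite -!flat_gramE [mxvec (X + Y)]linearD [(_ + _)^T]linearD mulmxDr mxE.
Qed.

Lemma lift_vec_horizontal X U c : N (mxvec X) != 0 ->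
  qinner e t (lift_vec X U) (cons_vec c (X *m rmul e c)) = 0.
Proof.
move=> N0; rewrite qinner_cons sformDl sform_lift_coef// sform_frame; ring.
Qed.

Lemma qinner_lift_vec X U V : N (mxvec X) != 0 ->
  qinner e t (lift_vec X U) (lift_vec X V) =
    N (mxvec X) * (mxvec U *m G (mxvec X) *m (mxvec V)^T) 0 0.
Proof.
move=> N0.
have -> : lift_vec X V = cons_vec 0 V + cons_vec (lift_coef X V) (X *m rmul e
  (lift_coef X V)).
  by rewrite cons_vecD add0r.
have qinnerDr x y z : qinner e t x (y + z) = qinner e t x y + qinner e t x z.
  rewrite [x]cons_vecE [y]cons_vecE [z]cons_vecE cons_vecD !qinner_cons sformDr
    !qformE linearD mulmxDr mxE.
  ring.
rewrite qinnerDr lift_vec_horizontal// addr0 qinner_cons.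
have -> : qform (lift_coef X U) 0 = 0 by rewrite qformE linear0 mulmx0 mxE.
rewrite oppr0 add0r sformDl -[in X in _ + X]flat_gramE -frameE -flat_gramE
  /lift_coef /proj_gram.
have distr (u v : 'rV[R]_(m * 4)) k (A B : 'M[R]_(m * 4)) :
    (u *m (k *: (A + k *: B)) *m v^T) 0 0 = k * ((u *m A *m v^T) 0 0 + k * (u *m
      B *m v^T) 0 0).
  rewrite -scalemxAr -scalemxAl mulmxDr mulmxDl -scalemxAr -scalemxAl.
  by rewrite [LHS]mxE; congr (_ * _); rewrite [LHS]mxE; congr (_ + _);
    rewrite [LHS]mxE.
rewrite distr mulrA mulfV// mul1r; congr (_ + _).
rewrite -!scalemxAl [LHS]mxE; congr (_ * fun_of_matrix _ _ _).
by rewrite /quat_proj !mulmxA.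
Qed.

Lemma qinnerBl (z W y : vec) : qinner e t (z - W) y = qinner e t z y - qinner e t
  W y.
Proof.
rewrite [z]cons_vecE [W]cons_vecE [y]cons_vecE cons_vecB !qinner_cons.
have -> p q c : qform (p - q) c = qform p c - qform q c.
  by rewrite !qformE !mulmxBl [LHS]mxE [X in _ + X]mxE.
have -> X Y U : sform (X - Y) U = sform X U - sform Y U.
  by rewrite -!flat_gramE [mxvec (X - Y)]linearB !mulmxBl [LHS]mxE [X in _ + X]mxE.
ring.
Qed.

Lemma rmulB p q : rmul e (p - q) = rmul e p - rmul e q.
Proof.
apply/row_matrixP => k; rewrite linearB/= !rowE !rmulE.
by apply: quatP; rewrite !mxE /=; ring.
Qed.

Lemma rmul0 : rmul e 0 = 0.
Proof. by rewrite -[0 in LHS](subrr 0) rmulB subrr. Qed.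

Lemma qmul1q c : qmul e (qone R) c = c.
Proof. by apply: quatP; rewrite !mxE /=; ring. Qed.

Lemma horizontal_lift_unique X W1 W2 q : N (mxvec X) != 0 -> qnorm e q != 0 ->
  let z := cons_vec q (X *m rmul e q) in
  horizontal e t z W1 -> horizontal e t z W2 ->
  'd (affine e 0) z W1 = 'd (affine e 0) z W2 -> W1 = W2.
Proof.
move=> N0 q0 z h1 h2; rewrite !diff_affine// => /(can_inj mxvecK).
move=> /(congr1 (mulmx^~ (rmul e q))); rewrite -!mulmxA rmulM qinv_mulq//.
rewrite rmul_one !mulmx1 => dW.
pose w := row 0 W1 - row 0 W2.
have WE : W1 - W2 = cons_vec w (X *m rmul e w).
  rewrite [W1]cons_vecE [W2]cons_vecE cons_vecB; congr cons_vec.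
  move/(canRL (subrK _)): dW => ->; rewrite rmulB mulmxBr.
  by rewrite addrC !addrA addNr add0r addrC.
suff w0 : w = 0.
  apply/eqP; rewrite -subr_eq0 WE w0 rmul0 mulmx0; apply/eqP/matrixP => a k.
  by rewrite !mxE; case: (unlift _ _) => *; rewrite ?mxE.
apply: (qform_nondeg ee) => c.
have : qinner e t (cons_vec w (X *m rmul e w)) (cons_vec c (X *m rmul e c)) = 0.
  have zc : rscale e z (qmul e (qinv e q) c) = cons_vec c (X *m rmul e c).
    rewrite rscale_cons -mulmxA rmulM qmulA qmulqV// qmul1q.
    by [].
  by rewrite -zc -WE qinnerBl h1 h2 subrr.
rewrite qinner_cons sform_frame => /eqP.
rewrite (_ : - _ + _ = - N (mxvec X) * qform w c); last by ring.
by rewrite mulf_eq0 oppr_eq0 (negPf N0) => /eqP.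
Qed.

Lemma horizontal_liftE X U q : N (mxvec X) != 0 -> qnorm e q != 0 ->
  horizontal_lift e t 0 (cons_vec q (X *m rmul e q)) (mxvec U) = rscale e
    (lift_vec X U) q.
Proof.
move=> N0 q0; set z := cons_vec _ _; set L := rscale _ _ _.
have hL : horizontal e t z L.
  move=> c; rewrite /z /L /lift_vec !rscale_cons.
  have adj p Y p' Y' : qinner e t (cons_vec (qmul e p q) (Y *m rmul e q))
    (cons_vec p' Y') =
      qinner e t (cons_vec p Y) (cons_vec (qmul e p' (qconj q)) (Y' *m rmul e
        (qconj q))).
    by rewrite !qinner_cons sform_adj qform_adj.
  rewrite adj -(mulmxA X (rmul e q)) rmulM -(mulmxA X (rmul e _)) rmulM.
  exact: (lift_vec_horizontal U (qmul e (qmul e q c) (qconj q)) N0).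
have dL : 'd (affine e 0) z L = mxvec U.
  rewrite diff_affine// /L /lift_vec rscale_cons row_cons_vec0 row'_cons_vec;
    congr mxvec.
  rewrite -rmulM mulmxA -mulmxBl -mulmxA rmulM qmulqV// addrK.
  by rewrite rmul_one mulmx1.
rewrite /horizontal_lift; apply: xget_unique => // W [hW dW].
by apply: (horizontal_lift_unique N0 q0 hW hL); rewrite dW dL.
Qed.

Lemma qinner_rscale (z w : vec) q :
  qinner e t (rscale e z q) (rscale e w q) = qnorm e q * qinner e t z w.
Proof.
rewrite [z]cons_vecE [w]cons_vecE !rscale_cons !qinner_cons qform_adj sform_adj
  -qmulA qmul_conj.
have prZr p k c : qform p (k *: c) = k * qform p c.
  by rewrite !qformE [(k *: c)^T]linearZ -scalemxAr mxE.
have sformZr X k Y : sform X (k *: Y) = k * sform X Y.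
  by rewrite -!flat_gramE [mxvec (k *: Y)]linearZ [(k *: _)^T]linearZ -scalemxAr
    mxE.
rewrite -mulmxA rmulM qmul_conj rmul1 qmulZr mul_mx_scalar prZr sformZr.
by rewrite qmulr1; ring.
Qed.

Lemma metric_lift X U V q : N (mxvec X) != 0 -> qnorm e q * N (mxvec X) = 1 ->
  let z := cons_vec q (X *m rmul e q) in
  qinner e t (horizontal_lift e t 0 z (mxvec U)) (horizontal_lift e t 0 z (mxvec
    V)) =
    (mxvec U *m G (mxvec X) *m (mxvec V)^T) 0 0.
Proof.
move=> N0 qN z.
have q0 : qnorm e q != 0 by apply: contra_eq_neq qN => ->;
  rewrite mul0r eq_sym oner_eq0.
rewrite !horizontal_liftE//.
have -> : qinner e t (rscale e (lift_vec X U) q) (rscale e (lift_vec X V) q) =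
    qnorm e q * qinner e t (lift_vec X U) (lift_vec X V) by exact: qinner_rscale.
by rewrite qinner_lift_vec// mulrA qN mul1r.
Qed.

Lemma structure_lift X U c (r : R) : N (mxvec X) != 0 -> r != 0 ->
  let z := cons_vec (r *: qone R) (X *m rmul e (r *: qone R)) in
  'd (affine e 0) z (rscale e (horizontal_lift e t 0 z (mxvec U)) c) = mxvec U *m
    Rmul e m c.
Proof.
move=> N0 r0 z; have q0 : qnorm e (r *: qone R) != 0.
  by rewrite qnormZ qnorm1 mulr1 sqrf_eq0.
rewrite horizontal_liftE// diff_affine// !rscale_cons row_cons_vec0 row'_cons_vec
  RmulE.
congr mxvec; set p := lift_coef X U.
have rE : rmul e (r *: qone R) = r%:M by exact: rmul1.
rewrite [X in X *m rmul e (qinv _ _)](_ : _ = U *m rmul e c *m rmul e (r *: qone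
  R)).
  rewrite -(mulmxA _ (rmul e (r *: _))) [rmul e (r *: _) *m _]rmulM qmulqV//.
  by rewrite rmul_one mulmx1.
by rewrite -2!rmulM !mulmxDl !mulmxA addrK rE !mul_mx_scalar -scalemxAl.
Qed.

End AffineChart.

Section Points.
Variables (R : realType) (e : R) (m t : nat).
Hypothesis ee : e * e = 1.
Local Notation vec := 'M[R]_(m.+1, 4).
Local Notation hyp := (@pseudo_hyperbolic R e m t).
Local Notation M := (projective e m t).
Local Notation N x := (hyp_factor (flat_gram e (@row_sign R m t)) x).
Implicit Types (z : hyp) (x u v : 'rV[R]_(m * 4)).

Lemma repr_proj (z : hyp) : exists s, qmul e s (qconj s) = qone R /\
  \val (repr (Defs.proj z)) = rscale e (\val z) s.
Proof.
have : same_orbit z (repr (Defs.proj z)).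
  by apply/(eqmodP (same_orbit_equiv e m t)); rewrite -[LHS]reprK.
by move=> /asboolP[s [s1 ->]]; exists s.
Qed.

Definition rep_scale x : R := (Num.sqrt (N x))^-1.

(* The representative with a real component 0, for which right multiplication by
   a constant reads the same in affine coordinates. *)
Definition affine_rep x : vec :=
  cons_vec (rep_scale x *: qone R) (vec_mx x *m rmul e (rep_scale x *: qone R)).

Lemma affine_repE x : affine_rep x = rscale e (cons_vec (qone R) (vec_mx x))
  (rep_scale x *: qone R).
Proof. by rewrite rscale_cons qmul1q. Qed.

Lemma rep_scaleK x : 0 < N x -> rep_scale x ^+ 2 * N x = 1.
Proof. by move=> N0; rewrite exprVn sqr_sqrtr ?ltW// mulVf// gt_eqF. Qed.

Lemma rep_scale_neq0 x : 0 < N x -> rep_scale x != 0.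
Proof. by move=> N0; rewrite invr_eq0 sqrtr_eq0 -ltNge. Qed.

Lemma qinner_affine_rep x c : qinner e t (rscale e (cons_vec (qone R) (vec_mx x)) c)
  (rscale e (cons_vec (qone R) (vec_mx x)) c) = - (qnorm e c * N x).
Proof.
rewrite qinner_rscale qinner_cons -[x in N x]vec_mxK hyp_factorE.
have -> : qform e (qone R) (qone R) = 1 by rewrite -[LHS]/(qnorm e (qone R)) qnorm1.
ring.
Qed.

Lemma affine_rep_hyp x : 0 < N x -> hyp (affine_rep x).
Proof.
by move=> N0; rewrite /pseudo_hyperbolic /= affine_repE qinner_affine_rep qnormZ
  qnorm1 mulr1 rep_scaleK.
Qed.

Definition affine_hyp x : hyp := insubd (SigSub (base_subproof e m t) : hyp)
  (affine_rep x).

Lemma affine_hypE x : 0 < N x -> \val (affine_hyp x) = affine_rep x.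
Proof. by move=> N0; rewrite val_insubd mem_set//; exact: affine_rep_hyp. Qed.

Definition affine_point x : M := Defs.proj (affine_hyp x).

Lemma repr_affine_point x : 0 < N x -> exists q,
  qnorm e q * N x = 1 /\ \val (repr (affine_point x)) = cons_vec q (vec_mx x *m
    rmul e q).
Proof.
move=> N0; have [s [s1 zE]] := repr_proj (affine_hyp x).
exists (qmul e (rep_scale x *: qone R) s); split.
  have ns : qnorm e s = 1 by rewrite /qnorm s1 /qre mxE.
  by rewrite qnormM ns mulr1 qnormZ qnorm1 mulr1 rep_scaleK.
by rewrite zE affine_hypE// rscale_cons -mulmxA rmulM.
Qed.

Let qN_neq0 (q : 'rV[R]_4) (k : R) : qnorm e q * k = 1 -> qnorm e q != 0.
Proof.
by move=> qN; apply: contra_eq_neq qN => ->; rewrite mul0r eq_sym oner_eq0.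
Qed.

Lemma affine_point_dom x : 0 < N x -> dom M 0 (affine_point x).
Proof.
move=> N0; have [q [qN zE]] := repr_affine_point N0.
by rewrite /= /proj_dom /= zE row_cons_vec0; exact: qN_neq0 qN.
Qed.

Lemma affine_point_chart x : 0 < N x -> chart M 0 (affine_point x) = x.
Proof.
move=> N0; have [q [qN zE]] := repr_affine_point N0.
rewrite /= /proj_chart zE affine0E row_cons_vec0 row'_cons_vec -mulmxA rmulM.
by rewrite qmulqV ?(qN_neq0 qN)// rmul_one mulmx1 vec_mxK.
Qed.

Lemma chart_inj (p : M) x : dom M 0 p -> chart M 0 p = x -> 0 < N x ->
  p = affine_point x.
Proof.
move=> pdom px N0; rewrite -[p]reprK; set z := repr p.
have z0 : qnorm e (row 0 (\val z)) != 0 by [].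
have zE : \val z = rscale e (cons_vec (qone R) (vec_mx x)) (row 0 (\val z)).
  by rewrite [LHS]cons_vecE rscale_cons qmul1q; congr cons_vec;
    rewrite -(affine_tail z0) -px.
have qN : qnorm e (row 0 (\val z)) * N x = 1.
  have : hyp (\val z) by exact: set_valP.
  by rewrite /pseudo_hyperbolic /= zE qinner_affine_rep -zE => /oppr_inj.
apply/esym/(eqmodP (same_orbit_equiv e m t))/asboolP.
exists ((rep_scale x)^-1 *: row 0 (\val z)); split.
  rewrite qmul_conj qnormZ.
  have -> : qnorm e (row 0 (\val z)) = rep_scale x ^+ 2.
    by apply: (mulIf (lt0r_neq0 N0)); rewrite qN rep_scaleK.
  by rewrite exprVn mulVf ?scale1r// sqrf_eq0 rep_scale_neq0.
rewrite affine_hypE// affine_repE {1}zE !rscaleE -mulmxA rmulM qmulZr -rmulE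
  -scalemxAl rmulE.
by rewrite qmul1q scalerA mulVf ?scale1r// rep_scale_neq0.
Qed.

Lemma param_affine_point x : 0 < N x -> param M 0 x = affine_point x.
Proof.
move=> N0; apply: xget_unique; first by split;
  [exact: affine_point_dom|exact: affine_point_chart].
by move=> p [pdom px]; exact: chart_inj.
Qed.

Lemma metric_affine_point x u v : 0 < N x ->
  metric M 0 (affine_point x) u v =
    (u *m proj_gram e (Rmul e m (qI R)) (Rmul e m (qJ R)) (flat_gram e (@row_sign
      R m t)) x *m v^T) 0 0.
Proof.
move=> N0; have [q [qN zE]] := repr_affine_point N0.
have := metric_lift (t := t) (X := vec_mx x) (q := q) ee (vec_mx u) (vec_mx v).
rewrite !vec_mxK /= /proj_metric zE => ->//; exact: lt0r_neq0.
Qed.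

Lemma structure_affine_point x c : 0 < N x -> qre c = 0 ->
  structure_bundle 0 (affine_point x) (fun u => u *m Rmul e m c).
Proof.
move=> N0 c0; exists (affine_hyp x), c; split => // u; rewrite affine_hypE//.
have := structure_lift (t := t) (X := vec_mx x) (r := rep_scale x) ee (vec_mx u) c.
rewrite !vec_mxK => ->//; [exact: lt0r_neq0|exact: rep_scale_neq0].
Qed.

End Points.

Lemma Cn_on_subset (R : realType) (V W : normedModType R) k (A A' : set V) (f :
  V -> W) :
  A `<=` A' -> Cn_on k A' f -> Cn_on k A f.
Proof.
move=> AA'; elim: k f => [|k IH] f /=; first by move=> fA x /AA'; exact: fA.
by move=> [df ddf]; split=> [x /AA'|v]; [exact: df|exact: IH].
Qed.

Lemma scalar_sum (R : realType) n (h : 'rV[R]_n -> R) (c : 'I_n ->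
  R) (w : 'I_n -> 'rV[R]_n) :
  scalar h -> h (\sum_k c k *: w k) = \sum_k c k * h (w k).
Proof.
move=> hlin; have h0 : h 0 = 0.
  by have := hlin 1 0 0; rewrite scale1r addr0 mul1r => /eqP;
    rewrite -subr_eq subrr => /eqP.
by elim/big_rec2: _ => // k x y _ <-; rewrite hlin.
Qed.

Lemma form_gram (R : realType) n (mu : 'rV[R]_n -> 'rV[R]_n ->
  R) (A : 'M[R]_n) u v :
  (forall w, scalar (mu w)) -> (forall w w', mu w w' = mu w' w) ->
  (forall k l, A k l = mu (delta_mx 0 k) (delta_mx 0 l)) ->
  (u *m A *m v^T) 0 0 = mu u v.
Proof.
move=> mulin musym AE; rewrite [in RHS](row_sum_delta v) scalar_sum// mxE.
apply: eq_bigr => l _; rewrite mxE [v^T _ _]mxE mulrC; congr (_ * _).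
rewrite musym [in RHS](row_sum_delta u) scalar_sum//.
by apply: eq_bigr => k _; rewrite AE musym.
Qed.

Section NoSubmersion.
Variables (R : realType) (e : R) (m t : nat).
Hypothesis ee : e * e = 1.
Local Notation vec := 'M[R]_(m.+1, 4).
Local Notation hyp := (@pseudo_hyperbolic R e m t).
Local Notation M := (projective e m t).
Local Notation b := (flat_gram e (@row_sign R m t)).
Local Notation N x := (hyp_factor b x).
Implicit Types (x u v : 'rV[R]_(m * 4)).

Lemma continuous_hyp_factor x : {for x, continuous (hyp_factor b : 'rV[R]_(m *
  4) -> R)}.
Proof.
apply: differentiable_continuous.
have coord k : differentiable (fun y : 'rV[R]_(m * 4) => y 0 k) x by exact:
  differentiable_coord.
rewrite (_ : hyp_factor b = cst 1 - \sum_(k < m * 4) ((b k k *: (fun y :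
  'rV[R]_(m * 4) => y 0 k)) * (fun y => y 0 k))).
  apply: differentiableB; first exact: differentiable_cst.
  by apply: differentiable_sum => k; apply: differentiableM => //;
    exact: differentiableZ.
apply/funext => y; rewrite /hyp_factor {1}/flat_gram mul_mx_diag.
rewrite [X in _ - X]mxE; congr (_ - _); rewrite fct_sumE; apply: eq_bigr => k _.
rewrite !mxE eqxx mulr1n; congr (_ * _); exact: mulrC.
Qed.

Lemma hyp_factor0_gt0 : 0 < N (0 : 'rV[R]_(m * 4)).
Proof. by rewrite /hyp_factor !mul0mx mxE subr0. Qed.

Lemma continuous_affine_rep : {for 0, continuous (@affine_rep R e m t : 'rV[R]_(m
  * 4) -> vec)}.
Proof.
have -> : @affine_rep R e m t = fun x => rep_scale e t x *: cons_vec (qone R)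
  (vec_mx x).
  apply/funext => x; rewrite affine_repE rscaleE rmul1 mul_mx_scalar.
  by [].
have cN := continuous_comp (@continuous_hyp_factor 0) (@sqrt_continuous R (N 0)).
have sN0 : (Num.sqrt \o hyp_factor b) (0 : 'rV[R]_(m * 4)) != 0.
  by rewrite /= sqrtr_eq0 -ltNge hyp_factor0_gt0.
apply: (continuousZ (continuousV sN0 cN)).
apply: differentiable_continuous; apply: differentiable_mx => a k.
case: (unliftP ord0 a) => [j ->|->].
  rewrite (_ : (fun _ => _) = (fun y : 'rV[R]_(m * 4) => y 0 (mxvec_index j k))).
    exact: differentiable_coord.
  by apply/funext => y; rewrite !mxE liftK ?mxE.
rewrite (_ : (fun _ => _) = cst (qone R 0 k)); first exact: differentiable_cst.
by apply/funext => y; rewrite !mxE unlift_none ?mxE.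
Qed.

Lemma near_affine_point (A : set M) : open A -> A (affine_point e t 0) ->
  \forall x \near (0 : 'rV[R]_(m * 4)), 0 < N x /\ A (affine_point e t x).
Proof.
move=> [U oU UA] A0.
have UE x : 0 < N x -> A (affine_point e t x) = U (affine_rep e t x).
  by move=> N0; rewrite -affine_hypE// -[U _]/((set_val @^-1` U) _) UA.
have N0 : \forall x \near (0 : 'rV[R]_(m * 4)), 0 < N x.
  by apply: (cvgr_gt _ (@continuous_hyp_factor 0)); exact: hyp_factor0_gt0.
have U0 : \forall x \near (0 : 'rV[R]_(m * 4)), U (affine_rep e t x).
  apply: continuous_affine_rep; apply: open_nbhs_nbhs; split => //.
  by rewrite -UE ?hyp_factor0_gt0.
by apply: filterS2 N0 U0 => x N0x Ux; rewrite UE.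
Qed.

Theorem no_structured_submersion n (B : charted_space R n) (f : M -> B) :
  pseudo_riemannian_manifold B -> (0 < n < m * 4)%N ->
  pseudo_riemannian_submersion f -> structured_fibres f -> False.
Proof.
move=> [[_ _ domB chartB _] [linB symB ndB smoothB _]] nm
  [[fcont fsmooth] _ fsub] fstr.
have [j domj] := domB (f (affine_point e t 0)).
have [oj _ _ _ paramB] := chartB j.
set fh := in_charts (M := M) (N := B) 0 j f.
pose good := [set x | 0 < N x /\ dom B j (f (affine_point e t x))].
pose O := interior good.
have O0 : O 0.
  apply: (near_affine_point (A := f @^-1` dom B j)) => //.
  by move/continuousP : fcont; exact.
have Ogood x : O x -> 0 < N x /\ dom B j (f (affine_point e t x)).
  exact: interior_subset.
have fhE x : 0 < N x -> fh x = chart B j (f (affine_point e t x)).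
  by move=> N0; rewrite /fh /in_charts /= -[proj_param _ _ _ _]/(param M 0 x)
    param_affine_point.
have fO : Cn_on 3 O fh.
  apply: Cn_on_subset (fsmooth 0 j 3%N) => x /Ogood[N0 dx].
  exists (affine_point e t x); last exact: affine_point_chart.
  by split => //; exact: affine_point_dom.
have tmE x u : O x ->
    tangent_map (M := M) (N := B) 0 j f (affine_point e t x) u = u *m 'J fh x.
  by move=> /Ogood[N0 _]; rewrite /tangent_map affine_point_chart// /jacobian
    mul_rV_lin1.
pose g (y : 'rV[R]_n) : 'M[R]_n :=
  \matrix_(k, l) metric B j (param B j y) (delta_mx 0 k) (delta_mx 0 l).
have gE x (u v : 'rV[R]_n) : O x ->
    (u *m g (fh x) *m v^T) 0 0 = metric B j (f (affine_point e t x)) u v.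
  move=> Ox; have [N0 dx] := Ogood x Ox.
  apply: form_gram => [w|w w' |k l]; [exact: linB|exact: symB|].
  by rewrite mxE fhE// paramB.
have subO x : O x ->
    dom M 0 (affine_point e t x) /\ dom B j (f (affine_point e t x)).
  by move=> /Ogood[N0 dx]; split => //; exact: affine_point_dom.
have ker c : qre c = 0 -> forall x, O x -> forall u, u *m 'J fh x = 0 ->
    u *m Rmul e m c *m 'J fh x = 0.
  move=> c0 x Ox u uD; have [d1 d2] := subO x Ox; have [N0 _] := Ogood x Ox.
  have := fstr 0 j _ d1 d2 _ u (structure_affine_point ee N0 c0).
  by rewrite /vertical /= !tmE//; exact.
apply: (no_quaternionic_submersion ee (Rmul_II e m) (Rmul_JJ e m) (Rmul_JI e m)
  (flat_gramT e (@row_sign R m t)) (flat_gram2 ee (@row_sign2 R m t))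
    (Rmul_flat_gramI e _) (Rmul_flat_gramJ e _)
  (open_interior good) fO _ _ (ker (qI R) _) (ker (qJ R) _) _ (g := g) _ _ O0 nm).
- by move=> x /Ogood[N0 _]; rewrite gt_eqF.
- move=> x Ox w; have [d1 d2] := subO x Ox; have [+ _ _] := fsub 0 j _ d1 d2.
  by move=> /(_ w)[u uw]; exists u; rewrite -tmE.
- by rewrite /qre !mxE.
- by rewrite /qre !mxE.
- move=> x Ox u uD un; have [d1 d2] := subO x Ox; have [N0 _] := Ogood x Ox.
  have [_ + _] := fsub 0 j _ d1 d2; apply; first by rewrite /vertical /= tmE.
  by move=> v vv; rewrite metric_affine_point//; apply: un; rewrite -tmE.
- move=> x Ox k l; have [N0 dx] := Ogood x Ox.
  have [+ _] := smoothB j (delta_mx 0 k) (delta_mx 0 l) 1%N.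
  rewrite fhE// => /(_ _ (imageP _ dx)).
  congr (differentiable _ _); apply/funext => y; by rewrite mxE.
- move=> x Ox u v nu nv; have [d1 d2] := subO x Ox; have [N0 _] := Ogood x Ox.
  have [_ _ +] := fsub 0 j _ d1 d2.
  move=> /(_ u v); rewrite !tmE// gE// metric_affine_point//; apply.
    by move=> w ww; rewrite metric_affine_point//; apply: nu; rewrite -tmE.
  by move=> w ww; rewrite metric_affine_point//; apply: nv; rewrite -tmE.
Qed.

End NoSubmersion.

Theorem corollary6p4 (R : realType) :
  (forall (m t : nat), (t <= m)%N ->
   forall (n : nat) (B : charted_space R n),
     pseudo_riemannian_manifold B -> (1 <= n)%N -> (n < 4 * m)%N ->
     ~ exists f : HH R m t -> B,
         [/\ pseudo_riemannian_submersion f,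
             connected_fibres f &
             quaternionic_fibres f]) /\
  (forall (m : nat) (n : nat) (B : charted_space R n),
     pseudo_riemannian_manifold B -> (1 <= n)%N -> (n < 4 * m)%N ->
     ~ exists f : BP R m -> B,
         [/\ pseudo_riemannian_submersion f,
             connected_fibres f &
             paraquaternionic_fibres f]).
Proof.
split=> [m t _|m] n B hB n0 nm [f [fsub _ fstr]].
- apply: (no_structured_submersion _ hB _ fsub fstr); first by rewrite mulrNN mulr1.
  by rewrite n0 mulnC.
- apply: (no_structured_submersion _ hB _ fsub fstr); first by rewrite mulr1.
  by rewrite n0 mulnC.
Qed.
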